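(* For $i=1,2$ let $\mathcal{H}_i$ be a weighted Hardy space with natural maximal domain $X_i\subseteq\mathbb{C}^{d_i}$. Assume that $\mathcal{H}_2$ is algebraically consistent on $X_2$. If $W_{\lambda,\varphi}:\mathcal{H}_2\to\mathcal{H}_1$ is an invertible weighted composition operator, then $\varphi:X_1\to X_2$ is a bijection and $W_{\lambda,\varphi}^{-1}$ is a weighted composition operator.
   Context: For $d\in\mathbb{N}$ and $r\in(0,\infty]$ let $r\mathbb{B}_d=\{z\in\mathbb{C}^d:|z|<r\}$ and $\overline{r\mathbb{B}_d}=\{z\in\mathbb{C}^d:|z|\le r\}$ (both equal to $\mathbb{C}^d$ if $r=\infty$); $\langle\cdot,\cdot\rangle_d$ is the standard inner product on $\mathbb{C}^d$. A Hilbert function space (RKHS) on a set $X$ is a Hilbert space of complex functions on $X$ all of whose point evaluations are bounded. Generating function: a power series $G(t)=\sum_{n\ge0}a_nt^n$ with $a_0=1$, $a_n>0$ for all $n$, and radius of convergence in $(0,\infty]$. Weighted Hardy space in $d$ variables: a Hilbert function space of holomorphic functions on a ball $r\mathbb{B}_d$, $r\in(0,\infty]$, in which the monomials $z^\alpha$ form a complete orthogonal set of nonzero vectors with $\|z^\alpha\|^2/\alpha!=\|z^\beta\|^2/\beta!$ whenever $|\alpha|=|\beta|$, and $\|\mathbf{1}\|=1$. Equivalently its reproducing kernel is $K(z,w)=G(\langle z,w\rangle_d)$ for a (unique) generating function $G=\sum a_nt^n$, and then $\|z^\alpha\|^{-2}=a_{|\alpha|}\frac{|\alpha|!}{\alpha!}$.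 Convention: every weighted Hardy space is regarded as a space of functions on its natural maximal domain $X$: if $r^2\in(0,\infty]$ is the radius of convergence of $G$, then $X=\mathbb{C}^d$ if $r=\infty$; $X=r\mathbb{B}_d$ if $r<\infty$ and $G(r^2)=\infty$; $X=\overline{r\mathbb{B}_d}$ if $r<\infty$ and $G(r^2)<\infty$ (functions then extend continuously to the closed ball). $\operatorname{Mult}(\mathcal{H})$ is the set of functions $\lambda:X\to\mathbb{C}$ with $\lambda f\in\mathcal{H}$ for all $f\in\mathcal{H}$; since $\mathbf 1\in\mathcal H$, $\operatorname{Mult}(\mathcal{H})\subseteq\mathcal{H}$. A nonzero bounded linear functional $\rho$ on $\mathcal{H}$ is multiplicative if $\rho(fg)=\rho(f)\rho(g)$ whenever $f,g,fg\in\mathcal{H}$; it is partially multiplicative if $\rho(\phi g)=\rho(\phi)\rho(g)$ whenever $\phi\in\operatorname{Mult}(\mathcal{H})$, $g\in\mathcal{H}$. $\mathcal{H}$ is algebraically consistent on $X$ if every partially multiplicative functional on $\mathcal{H}$ is multiplicative. For Hilbert function spaces $\mathcal{H}_i$ on $X_i$, a weighted composition operator $W_{\lambda,\varphi}:\mathcal{H}_2\to\mathcal{H}_1$ is a bounded operator $f\mapsto\lambda\,(f\circ\varphi)$ with $\varphi:X_1\to X_2$ and $\lambda:X_1\to\mathbb{C}$; it is invertible if it is a bounded bijection. *)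

(* Defs.v *)
From HB Require Import structures.
From mathcomp Require Import all_boot all_order all_algebra.
From mathcomp Require Import sesquilinear complex.
From mathcomp Require Import all_classical all_reals all_analysis.
Set Implicit Arguments.
Unset Strict Implicit.
Unset Printing Implicit Defensive.
Import Order.TTheory GRing.Theory Num.Theory.
Import numFieldNormedType.Exports.
Local Open Scope classical_set_scope.
Local Open Scope complex_scope.
Local Open Scope ring_scope.

(* The usual topology of the complex numbers. *)
HB.instance Definition _ (R : realType) := PseudoPointedMetric.copy R[i] R[i]^o.

(* A Hilbert space of functions on [X] is an abstract Hilbert space together  *)
(* with an injective linear map [hfs_fun] to the functions on [X]; membership *)
(* of a function in the space means being in the image of [hfs_fun].  The     *)
(* inner product is linear in its first and conjugate-linear in its second    *)
(* argument.  Boundedness of linear maps is continuity, throughout.           *)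
Record hilbert_function_space (R : realType) (X : Type) := HilbertFunctionSpace {
  hfs_space :> completeNormedModType R[i];
  hfs_dot : {dot hfs_space for @Num.conj R[i]};
  hfs_norm_dot : forall f : hfs_space, `|f| ^+ 2 = hfs_dot f f;
  hfs_fun : {linear hfs_space -> (X -> R[i]^o)};
  hfs_fun_inj : injective hfs_fun;
  hfs_eval_continuous : forall x : X, continuous (fun f => hfs_fun f x)
}.
Arguments hfs_dot {R X h}.
Arguments hfs_fun {R X h}.

Section HilbertFunctionSpaces.
Variables (R : realType) (X : Type) (H : hilbert_function_space R X).

Definition multiplier (l : X -> R[i]) : Prop :=
  forall f : H, exists g : H, forall x, hfs_fun g x = l x * hfs_fun f x.

Definition is_product (f g h : H) : Prop :=
  forall x, hfs_fun h x = hfs_fun f x * hfs_fun g x.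

Definition nonzero_bounded (rho : {linear H -> R[i]^o}) : Prop :=
  continuous rho /\ exists f, rho f != 0.

Definition multiplicative_functional (rho : {linear H -> R[i]^o}) : Prop :=
  nonzero_bounded rho /\
  forall f g h, is_product f g h -> rho h = rho f * rho g.

Definition partially_multiplicative (rho : {linear H -> R[i]^o}) : Prop :=
  nonzero_bounded rho /\
  forall p g h, multiplier (hfs_fun p) -> is_product p g h ->
    rho h = rho p * rho g.

Definition algebraically_consistent : Prop :=
  forall rho, partially_multiplicative rho -> multiplicative_functional rho.

Definition reproducing_kernel (K : X -> X -> R[i]) : Prop :=
  forall w, exists k : H,
    (forall z, hfs_fun k z = K z w) /\
    (forall f : H, hfs_fun f w = hfs_dot f k).

End HilbertFunctionSpaces.

Definition weighted_composition (R : realType) (X1 X2 : Type)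
    (H1 : hilbert_function_space R X1) (H2 : hilbert_function_space R X2)
    (l : X1 -> R[i]) (phi : X1 -> X2) (W : {linear H2 -> H1}) : Prop :=
  continuous W /\
  forall f x, hfs_fun (W f) x = l x * hfs_fun f (phi x).

Section GeneratingFunctions.
Variable R : realType.

Definition convergence_radius (a : R^nat) : \bar R :=
  ereal_sup [set `|t|%:E | t in [set t : R | cvgn (pseries a t)]].

Definition generating_function (a : R^nat) : Prop :=
  [/\ a 0%N = 1, forall n, 0 < a n & (0 < convergence_radius a)%E].

(* Meaningful where the series converges, in particular at [cdot z w] for all *)
(* [z], [w] in [natural_domain a].                                            *)
Definition genfun_value (a : R^nat) (t : R[i]) : R[i] :=
  limn (series (fun n => (a n)%:C * t ^+ n) : R[i]^o^nat).

End GeneratingFunctions.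

Section WeightedHardySpaces.
Variables (R : realType) (d : nat).

Definition cdot (z w : 'rV[R[i]]_d) : R[i] :=
  \sum_(i < d) z ord0 i * (w ord0 i)^*%C.

(* [`|z|] would be the supremum norm. *)
Definition cnorm (z : 'rV[R[i]]_d) : R := Num.sqrt (complex.Re (cdot z z)).

Definition oball (r : \bar R) : set 'rV[R[i]]_d :=
  [set z | ((cnorm z)%:E < r)%E].

Definition cball (r : \bar R) : set 'rV[R[i]]_d :=
  [set z | ((cnorm z)%:E <= r)%E].

(* The square of [ball_radius a] is the radius of convergence. *)
Definition ball_radius (a : R^nat) : \bar R := sqrte (convergence_radius a).

Definition natural_domain (a : R^nat) : set 'rV[R[i]]_d :=
  let r := ball_radius a in
  if `[< (r < +oo)%E /\ cvgn (pseries a (fine r ^+ 2)) >]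
  then cball r else oball r.

Definition multiindex := {ffun 'I_d -> nat}.

Definition mdeg (al : multiindex) : nat := (\sum_(i < d) al i)%N.

Definition mfact (al : multiindex) : nat := (\prod_(i < d) (al i)`!)%N.

Definition monomial (al : multiindex) (z : 'rV[R[i]]_d) : R[i] :=
  \prod_(i < d) z ord0 i ^+ al i.

Variables (X : set 'rV[R[i]]_d) (H : hilbert_function_space R X).

(* [differentiable] over the field [R[i]] is complex differentiability.  The  *)
(* continuity clause adds something only when [X] is a closed ball.           *)
Definition holomorphic_functions (r : \bar R) : Prop :=
  forall f : H, exists g : 'rV[R[i]]_d -> R[i]^o,
    [/\ forall x : X, hfs_fun f x = g (val x),
        forall z, oball r z -> differentiable g z &
        {within X, continuous g}].

(* [m al] is the element of [H] given by the monomial [z ^ al]. *)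
Definition weighted_monomials (m : multiindex -> H) : Prop :=
  [/\ forall al (x : X), hfs_fun (m al) x = monomial al (val x),
      forall al, m al != 0,
      forall al be, al != be -> hfs_dot (m al) (m be) = 0,
      forall f : H, (forall al, hfs_dot f (m al) = 0) -> f = 0 &
      (forall al be, mdeg al = mdeg be ->
        `|m al| ^+ 2 / (mfact al)%:R = `|m be| ^+ 2 / (mfact be)%:R) /\
      `|m [ffun=> 0%N]| = 1].

Definition weighted_hardy_space : Prop :=
  (exists m, weighted_monomials m) /\
  exists a : R^nat,
    [/\ generating_function a,
        reproducing_kernel H
          (fun z w => genfun_value a (cdot (val z) (val w))),
        X = natural_domain a &
        holomorphic_functions (ball_radius a)].

End WeightedHardySpaces.

(* Main.v *)
Require Import Defs.
From HB Require Import structures.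
From mathcomp Require Import all_boot all_order all_algebra.
From mathcomp Require Import sesquilinear complex.
From mathcomp Require Import all_classical all_reals all_analysis.
From mathcomp Require Import ring lra.
Set Implicit Arguments.
Unset Strict Implicit.
Unset Printing Implicit Defensive.
Import Order.TTheory GRing.Theory Num.Theory.
Import numFieldNormedType.Exports.
Local Open Scope classical_set_scope.
Local Open Scope complex_scope.
Local Open Scope ring_scope.

(**
Write [W f = l * (f \o phi)] and let [V] be the inverse of [W] as a linear map.
The difficulty is surjectivity of [phi]: for a point [y] of [X2], the
functional [rho g := (V g)(y)] on [H1] has to be a multiple of the evaluation
at some point of [X1].  This would be immediate if the coordinate functions of
[H1] were multipliers with [rho (z_i g) = w_i * rho g] (lemma
[eigenfunctional]): then [rho] is, up to a constant, evaluation at [w] on the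
monomials, and its boundedness puts [w] in the natural domain, because
[\sum_(|al| = n) |w^al|^2 / ||z^al||^2 = a_n |w|^(2n)] (lemma [shellE]).

Coordinates become multipliers as follows.
- If some multiplier of a weighted Hardy space has a nonzero first-order
  coefficient, then multiplication by it, which is bounded by the uniform
  boundedness principle, bounds [||z_1^(n+1)|| / ||z_1^n||]
  ([multiplier_growth]); since norms of monomials of equal degree are tied
  together, every coordinate is then a bounded multiplier
  ([coordinate_multiplication]).
- In [H2] such a multiplier exists by algebraic consistency.  Otherwise
  [f |-> f(0) + (d_1 f)(0)] would be partially multiplicative, but it is not
  multiplicative, as its values at [z_1] and [z_1^2] are [1] and [0]
  ([consistent_growth]).
- Conjugating with [W], the coordinates [phi_j] of [phi] are multipliers of
  [H1].  They cannot all have vanishing derivative at [0] in the direction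
  [z_1]: otherwise [g |-> g(0)] and [g |-> (d_1 g)(0)], composed with [W], would
  be joint eigenfunctionals of the coordinate multiplications of [H2] for the
  same eigenvalues, hence proportional, and they are not
  ([symbol_derivative_neq0]).  So [H1] too has all its coordinates as
  multipliers.

Finally multiplication by [z_i] on [H1], transported to [H2], commutes with
the coordinate multiplications of [H2], so [f |-> rho (z_i * W f)] is again a
joint eigenfunctional with eigenvalues the coordinates of [y], that is, a
multiple [w_i] of the evaluation at [y] ([evaluation_pullback]).  This is the
relation [rho (z_i g) = w_i * rho g] needed above.

Values and derivatives at [0] are encoded as coefficients of the orthogonal
expansion along the monomials [z_1^n].  Products of functions are related to
these coefficients by restricting to the ray [t * e_1], where the orthogonal
expansion becomes a power series in [t].
*)

(** * Real-valued norms over the complex numbers *)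

Section RealNorm.
Context {R : realType}.
Implicit Types V W : normedModType R[i].

(** Norms over [R[i]] are complex numbers with zero imaginary part; the real
    part makes total-order arguments available. *)
Definition rnorm V (v : V) : R := complex.Re `|v|.

Lemma rnormE V (v : V) : `|v| = (rnorm v)%:C.
Proof. by rewrite /rnorm RRe_real ?normr_real. Qed.

Lemma rnorm_ge0 V (v : V) : 0 <= rnorm v.
Proof. by rewrite -ler0c -rnormE. Qed.

Lemma rnorm_le V (v : V) (c : R) : (`|v| <= c%:C) = (rnorm v <= c).
Proof. by rewrite rnormE lecR. Qed.

Lemma rnorm0 V : rnorm (0 : V) = 0.
Proof. by rewrite /rnorm normr0. Qed.

Lemma rnorm_eq0 V (v : V) : rnorm v = 0 -> v = 0.
Proof. by move=> v0; apply/normr0_eq0; rewrite rnormE v0. Qed.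

Lemma rnorm_gt0 V (v : V) : v != 0 -> 0 < rnorm v.
Proof.
by move=> v0; rewrite lt_def rnorm_ge0 andbT; apply: contra_neq v0 => /rnorm_eq0.
Qed.

Lemma rnormN V (v : V) : rnorm (- v) = rnorm v.
Proof. by rewrite /rnorm normrN. Qed.

Lemma rnormD V (v w : V) : rnorm (v + w) <= rnorm v + rnorm w.
Proof. by rewrite -lecR rmorphD/= -!rnormE; exact: ler_normD. Qed.

Lemma rnormZ V (a : R[i]^o) (v : V) : rnorm (a *: v) = rnorm a * rnorm v.
Proof.
apply: complexI; rewrite rmorphM/= -!rnormE normrZ.
by congr (_ * _).
Qed.

Lemma rnormM (a b : R[i]^o) : rnorm (a * b : R[i]^o) = rnorm a * rnorm b.
Proof. exact: rnormZ. Qed.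

Lemma rnormC (a : R) : rnorm (a%:C : R[i]^o) = `|a|.
Proof. by rewrite /rnorm normc_def /= expr0n addr0 sqrtr_sqr. Qed.

Lemma rnormB V (v w : V) : rnorm (v - w) = rnorm (w - v).
Proof. by rewrite -rnormN opprB. Qed.

Lemma rnorm_sum V (I : Type) (r : seq I) (P : pred I) (F : I -> V) :
  rnorm (\sum_(i <- r | P i) F i) <= \sum_(i <- r | P i) rnorm (F i).
Proof.
elim/big_rec2: _ => [|i x y _ le_yx]; first by rewrite rnorm0.
by apply: le_trans (rnormD _ _) _; rewrite lerD2l.
Qed.

Lemma cvg_rnormP V (u : V^nat) (l : V) :
  u @ \oo --> l <->
  forall e, 0 < e -> exists N, forall n, (N <= n)%N -> rnorm (l - u n) <= e.
Proof.
split=> [/cvgrPdist_le ul e e0|ul].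
  have /ul[N _ Nu] : (0 : R[i]) < e%:C by rewrite ltcR.
  by exists N => n Nn; rewrite -rnorm_le; apply: Nu.
apply/cvgrPdist_le => -[e i] /=; rewrite ltcE/= => /andP[/eqP -> e0].
have [N Nu] := ul e e0.
by exists N => // n Nn; rewrite (_ : e +i* 0 = e%:C)// rnorm_le; apply: Nu.
Qed.

Lemma cauchy_rnorm_cvg (V : completeNormedModType R[i]) (u : V^nat) :
  (forall e, 0 < e -> exists N, forall n p, (N <= n)%N -> (N <= p)%N ->
    rnorm (u n - u p) <= e) ->
  exists l : V, u @ \oo --> l.
Proof.
move=> cu; suff : cvgn u by move=> ?; exists (limn u).
apply: cauchy_cvg; apply: cauchy_exP => -[e i] /=.
rewrite ltcE/= => /andP[/eqP -> e0].
have [N Nu] := cu (e / 2) (divr_gt0 e0 (ltr0Sn _ _)).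
exists (u N), N => // n /= Nn.
rewrite -ball_normE /= rnormE ltcR; apply: le_lt_trans (Nu _ _ (leqnn _) Nn) _.
by rewrite gtr_pMr// invf_lt1// ltr1n.
Qed.

Lemma continuous_rnormP V W (f : {linear V -> W}) :
  continuous f <-> exists C, forall x, rnorm (f x) <= C * rnorm x.
Proof.
split=> [/linear_bounded_continuous/linear_boundedP[M [Mreal Mf]]|[C Cf]].
  exists (`|complex.Re M| + 1) => x; rewrite -lecR -rnormE rmorphM/= -rnormE.
  apply: Mf; case: M Mreal => a b; rewrite complex_real/= => /eqP ->.
  by rewrite ltcR; have := ler_norm a; lra.
apply/linear_bounded_continuous/linear_boundedP.
exists C%:C; split; first by apply/complex_realP; exists C.
case=> a b; rewrite ltcE/= => /andP[/eqP -> Ca] x.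
rewrite (_ : a +i* 0 = a%:C)// !rnormE -rmorphM lecR.
by apply: le_trans (Cf x) _; rewrite ler_wpM2r ?rnorm_ge0 ?ltW.
Qed.

End RealNorm.

(** * Uniform boundedness *)

(** Gliding hump.  If the family is unbounded on balls, then one of [x + u] and
    [x - u] makes [l i] at least as large as [u] does, because
    [2 * l i u = l i (x + u) - l i (x - u)].  So the centre of any ball can be
    moved slightly to a point where some [l i] exceeds a prescribed bound, and
    it does so on a smaller ball; at the limit of the nested balls the family
    is not bounded. *)
Lemma uniform_boundedness (R : realType) (V : completeNormedModType R[i])
    (W : normedModType R[i]) (I : Type) (l : I -> {linear V -> W}) :
  (forall i, continuous (l i)) ->
  (forall x, exists M, forall i, rnorm (l i x) <= M) ->
  exists C, forall i x, rnorm (l i x) <= C * rnorm x.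
Proof.
move=> lcont lbnd; apply: contrapT => nobound.
have large M e : 0 < e -> exists i u, rnorm u <= e /\ M < rnorm (l i u).
  move=> e0; apply: contrapT => noiu; apply: nobound; exists (M / e) => i x.
  have [->|x0] := eqVneq x 0; first by rewrite linear0 !rnorm0 mulr0.
  have rx := rnorm_gt0 x0.
  rewrite leNgt; apply/negP => Mlt; apply: noiu.
  exists i, ((e / rnorm x)%:C *: x).
  have er : `|e / rnorm x| = e / rnorm x by rewrite ger0_norm// divr_ge0// ltW.
  rewrite linearZ !rnormZ !rnormC er divfK ?gt_eqF//; split=> //.
  have -> : M = e / rnorm x * (M / e * rnorm x) by field; rewrite !gt_eqF.
  by rewrite ltr_pM2l ?divr_gt0.
(* [q] carries the bound to beat and the centre and radius of a ball. *)
have step (q : nat * (V * R)) : exists s : V * R, 0 < q.2.2 ->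
    [/\ 0 < s.2, s.2 <= q.2.2 / 2, rnorm (s.1 - q.2.1) + s.2 <= q.2.2 &
      exists i, forall y, rnorm (y - s.1) <= s.2 -> q.1%:R < rnorm (l i y)].
  case: q => n [x r] /=.
  have [r0|r0] := leP r 0; first by exists (x, r); rewrite ltNge r0.
  have [i [u [ur nu]]] := large (n%:R + 1) (r / 2) (divr_gt0 r0 (ltr0Sn _ _)).
  have [x' [x'x nx']] : exists x', rnorm (x' - x) = rnorm u /\
      n%:R + 1 < rnorm (l i x').
    have : rnorm (l i u) + rnorm (l i u) <=
        rnorm (l i (x + u)) + rnorm (l i (x - u)).
      rewrite -[X in _ <= _ + X]rnormN; apply: le_trans _ (rnormD _ _).
      rewrite -linearB/=.
      have -> : x + u - (x - u) = (2 : R)%:C *: u.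
        by rewrite opprB addrC addrA subrK rmorph_nat scaler_nat mulr2n.
      by rewrite linearZ rnormZ rnormC normr_nat mulr_natl mulr2n.
    have [xu|xu] := ltP (n%:R + 1) (rnorm (l i (x + u))) => luu.
      by exists (x + u); rewrite addrAC subrr add0r.
    by exists (x - u); rewrite addrAC subrr add0r rnormN; split=> //; lra.
  have [K Kl] := (continuous_rnormP (l i)).1 (lcont i).
  have K0 : 0 < `|K| + 1 by rewrite ltr_wpDl.
  exists (x', Order.min (r / 2) (`|K| + 1)^-1) => _ /=; split.
  - by rewrite lt_min divr_gt0// invr_gt0.
  - by rewrite ge_min lexx.
  - rewrite x'x (@le_trans _ _ (r / 2 + r / 2))//; last by lra.
    by rewrite lerD// ge_min lexx.
  exists i => y yx'.
  have : rnorm (l i x') <= rnorm (l i y) + 1.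
    have -> : x' = y - (y - x') by rewrite opprB addrC subrK.
    rewrite linearB/=; apply: le_trans (rnormD _ _) _.
    rewrite lerD2l rnormN; apply: le_trans (Kl _) _.
    apply: (@le_trans _ _ ((`|K| + 1) * rnorm (y - x'))).
      by rewrite ler_wpM2r ?rnorm_ge0//; have := ler_norm K; lra.
    rewrite -ler_pdivlMl// mulr1; apply: le_trans yx' _.
    by rewrite ge_min lexx orbT.
  by lra.
have [g gP] := choice step.
pose s := fix s n := if n is n'.+1 then g (n', s n') else (0 : V, 1 : R).
have s0 n : 0 < (s n).2.
  by elim: n => [|n IHn]; [exact: ltr01|have [] := gP (n, s n) IHn].
have sS n := gP (n, s n) (s0 n).
have s_small n : (s n).2 * n.+1%:R <= 1.
  elim: n => [|n IHn]; first by rewrite mulr1.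
  have [_ sn _ _] := sS n; apply: le_trans IHn.
  apply: (@le_trans _ _ ((s n).2 / 2 * n.+2%:R)); first by rewrite ler_wpM2r.
  have n0 : 0 <= n%:R :> R by [].
  rewrite -mulrA ler_pM2l ?s0//.
  have -> : n.+2%:R = n%:R + 2 :> R by rewrite -addn2 natrD.
  have -> : n.+1%:R = n%:R + 1 :> R by rewrite natr1.
  by lra.
have nested n p : rnorm ((s (n + p)%N).1 - (s n).1) + (s (n + p)%N).2 <= (s n).2.
  elim: p => [|p IHp]; first by rewrite addn0 subrr rnorm0 add0r.
  rewrite addnS; have [_ _ + _] := sS (n + p)%N.
  have -> : (s (n + p).+1).1 - (s n).1 =
     ((s (n + p).+1).1 - (s (n + p)%N).1) + ((s (n + p)%N).1 - (s n).1).
    by rewrite addrA subrK.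
  have := rnormD ((s (n + p).+1).1 - (s (n + p)%N).1) ((s (n + p)%N).1 - (s n).1).
  by rewrite /=; lra.
have near_ n p : (n <= p)%N -> rnorm ((s p).1 - (s n).1) <= (s n).2.
  by move=> /subnKC <-; have := nested n (p - n)%N; have := s0 (n + (p - n))%N; lra.
have s_to0 e : 0 < e -> exists N, (s N).2 <= e.
  move=> e0; exists (Num.truncn e^-1); have := s_small (Num.truncn e^-1).
  rewrite -ler_pdivlMr// mul1r => /le_trans; apply.
  by rewrite -[leRHS]invrK lef_pV2 ?posrE ?invr_gt0// ltW// truncnS_gt.
have [x sx] : exists x : V, (fun n => (s n).1) @ \oo --> x.
  apply: cauchy_rnorm_cvg => e e0.
  have [N sN] := s_to0 _ (divr_gt0 e0 (ltr0Sn _ 1)).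
  exists N => n p Nn Np.
  have -> : (s n).1 - (s p).1 = ((s n).1 - (s N).1) + ((s N).1 - (s p).1).
    by rewrite addrA subrK.
  apply: le_trans (rnormD _ _) _; rewrite (rnormB (s N).1).
  by have := near_ N n Nn; have := near_ N p Np; lra.
have xs n : rnorm (x - (s n).1) <= (s n).2.
  apply/ler_addgt0Pr => e e0; have [N Nx] := (cvg_rnormP _ _).1 sx e e0.
  have -> : x - (s n).1 = (x - (s (n + N)%N).1) + ((s (n + N)%N).1 - (s n).1).
    by rewrite addrA subrK.
  apply: le_trans (rnormD _ _) _; rewrite addrC lerD//.
    by apply: near_; exact: leq_addr.
  by apply: Nx; exact: leq_addl.
have [M Mx] := lbnd x.
have [_ _ _ [i li]] := sS (Num.truncn M).+1.
have /= Mi := li x (xs (Num.truncn M).+2).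
have := Mx i; apply/negP; rewrite -ltNge; apply: le_lt_trans Mi.
by rewrite ltW// truncnS_gt.
Qed.

(** * Density and bounded inverses in Hilbert spaces *)

Section Hilbert.
Context {R : realType} {H : completeNormedModType R[i]}.
Context {dot : {dot H for @Num.conj R[i]}}.
Hypothesis norm_dot : forall f : H, `|f| ^+ 2 = dot f f.

Lemma dot_sqr f : dot f f = (rnorm f ^+ 2)%:C.
Proof. by rewrite -norm_dot rnormE rmorphXn. Qed.

Lemma dotC f g : dot f g = Num.conj (dot g f).
Proof. by rewrite hermC expr0 mul1r. Qed.

Lemma pythagoras f g : dot f g = 0 ->
  rnorm (f + g) ^+ 2 = rnorm f ^+ 2 + rnorm g ^+ 2.
Proof.
move=> fg; apply: complexI; rewrite [RHS]rmorphD/= -!dot_sqr.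
by rewrite hnormDd.
Qed.

Lemma dotZl a f g : dot (a *: f) g = a * dot f g.
Proof. by rewrite linearZl_LR. Qed.

Lemma dotZr a f g : dot f (a *: g) = Num.conj a * dot f g.
Proof. by rewrite linearZr_LR. Qed.

(** Pythagoras for [f] and its projection on [g]; it yields both the
    Cauchy-Schwarz inequality and the orthogonality of nearest points. *)
Lemma rnorm_proj f g : g != 0 ->
  rnorm f ^+ 2 =
  rnorm (f - (dot f g / dot g g) *: g) ^+ 2 +
  rnorm (dot f g : R[i]^o) ^+ 2 / rnorm g ^+ 2.
Proof.
move=> g0; have gg0 : dot g g != 0 by rewrite dnorm_eq0.
have rg0 : rnorm g != 0 by rewrite gt_eqF ?rnorm_gt0.
rewrite -[in LHS](subrK ((dot f g / dot g g) *: g) f) pythagoras; last first.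
  by rewrite dotZr linearBl/= dotZl divfK// subrr mulr0.
congr (_ + _); rewrite dot_sqr rnormZ -fmorphV rnormM rnormC.
by rewrite ger0_norm ?invr_ge0 ?sqr_ge0//; field.
Qed.

Lemma cauchy_schwarz f g : rnorm (dot f g : R[i]^o) <= rnorm f * rnorm g.
Proof.
have [->|g0] := eqVneq g 0; first by rewrite linear0r !rnorm0 mulr0.
have rg0 := rnorm_gt0 g0.
rewrite -(@ler_pXn2r _ 2)// ?nnegrE ?mulr_ge0 ?rnorm_ge0//.
rewrite exprMn -ler_pdivrMr ?exprn_gt0// (rnorm_proj f g0).
by rewrite lerDr sqr_ge0.
Qed.

Lemma parallelogram (f g : H) :
  rnorm (f + g) ^+ 2 + rnorm (f - g) ^+ 2 = 2 * rnorm f ^+ 2 + 2 * rnorm g ^+ 2.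
Proof.
rewrite !mulr_natl !mulr2n; apply: complexI.
by rewrite !rmorphD/= -!dot_sqr dnormD dnormB; ring.
Qed.

(** A minimizing sequence for the distance from [f] to [D] is Cauchy by the
    parallelogram law; its limit [p] satisfies [f - p] orthogonal to [D], hence
    [p = f]. *)
Lemma total_dense (D : set H) :
  D 0 -> (forall f g, D f -> D g -> D (f + g)) ->
  (forall a f, D f -> D (a *: f)) ->
  (forall f, (forall g, D g -> dot f g = 0) -> f = 0) ->
  forall f e, 0 < e -> exists g, D g /\ rnorm (f - g) <= e.
Proof.
move=> D0 DD DZ Dperp f.
pose S := [set rnorm (f - g) ^+ 2 | g in D].
have S_inf : has_inf S.
  split; first by exists (rnorm (f - 0) ^+ 2), 0.
  by exists 0 => _ [g _ <-]; exact: sqr_ge0.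
pose m := inf S.
have m_le g : D g -> m <= rnorm (f - g) ^+ 2.
  by move=> Dg; apply: ge_inf; [case: S_inf|exists g].
have /choice[u uP] (n : nat) :
    exists g, D g /\ rnorm (f - g) ^+ 2 < m + n.+1%:R^-1.
  have n0 : (0 : R) < n.+1%:R^-1 by rewrite invr_gt0.
  by have [_ [g Dg <-] ?] := inf_adherent n0 S_inf; exists g.
have [p up] : exists p : H, u @ \oo --> p.
  apply: cauchy_rnorm_cvg => e e0.
  have e20 : 0 < e ^+ 2 / 4 by rewrite divr_gt0// exprn_gt0.
  exists (Num.truncn (e ^+ 2 / 4)^-1) => i j Ni Nj.
  have small n : (Num.truncn (e ^+ 2 / 4)^-1 <= n)%N -> n.+1%:R^-1 <= e ^+ 2 / 4.
    move=> Nn; rewrite -[leRHS]invrK lef_pV2 ?posrE ?invr_gt0//.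
    by apply: le_trans (ltW (truncnS_gt _)) _; rewrite ler_nat ltnS.
  have [[Di ui] [Dj uj]] := (uP i, uP j).
  rewrite -(@ler_pXn2r _ 2)// ?nnegrE ?rnorm_ge0 ?(ltW e0)//.
  have := parallelogram (f - u j) (f - u i).
  have -> : f - u j - (f - u i) = u i - u j.
    by rewrite opprB addrC -addrA (addrA (- f)) addNr add0r.
  have -> : f - u j + (f - u i) = (2 : R)%:C *: (f - (2^-1 : R)%:C *: (u i + u j)).
    rewrite scalerBr scalerA -rmorphM/= divff// scale1r rmorph_nat.
    by rewrite scaler_nat mulr2n addrACA opprD [- u j - u i]addrC.
  rewrite rnormZ rnormC ger0_norm// exprMn.
  have := m_le _ (DZ (2^-1 : R)%:C _ (DD _ _ Di Dj)).
  have := small i Ni; have := small j Nj.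
  move: (i.+1%:R^-1) (j.+1%:R^-1) ui uj => ei ej; lra.
have fp : f - p = 0.
  apply: Dperp => g Dg; have [->|g0] := eqVneq g 0; first by rewrite linear0r.
  have rg0 := rnorm_gt0 g0.
  suff small (e : R) : 0 < e -> rnorm (dot (f - p) g : R[i]^o) <= e.
    apply: (@rnorm_eq0 _ R[i]^o); apply/eqP; rewrite eq_le rnorm_ge0 andbT.
    by apply/ler_addgt0Pr => e /small; rewrite add0r.
  move=> e0.
  have [d d0 ed] : exists2 d, 0 < d & e = d * rnorm g + d * rnorm g.
    exists (e / (2 * rnorm g)); first by rewrite divr_gt0// mulr_gt0.
    by field; rewrite gt_eqF.
  have [N Nd] := (cvg_rnormP _ _).1 up d d0.
  pose n := maxn N (Num.truncn (d ^+ 2)^-1).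
  have nd : n.+1%:R^-1 <= d ^+ 2.
    rewrite -[leRHS]invrK lef_pV2 ?posrE ?invr_gt0 ?exprn_gt0//.
    apply: le_trans (ltW (truncnS_gt _)) _.
    by rewrite ler_nat ltnS leq_maxr.
  have [Dn un] := uP n.
  (* [u n] is within [d ^+ 2] of minimizing the squared distance, and projecting
     [f - u n] away from [g] cannot gain more than that. *)
  have h1 : rnorm (dot (f - u n) g : R[i]^o) <= d * rnorm g.
    rewrite -(@ler_pXn2r _ 2)// ?nnegrE ?rnorm_ge0 ?mulr_ge0 ?rnorm_ge0 ?(ltW d0)//.
    rewrite exprMn -ler_pdivrMr ?exprn_gt0//.
    pose c := dot (f - u n) g / dot g g.
    rewrite -(lerD2l (rnorm (f - u n - c *: g) ^+ 2)) -rnorm_proj//.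
    apply: ltW; apply: lt_le_trans un _; apply: lerD => //.
    by rewrite -addrA -opprD; exact/m_le/DD/DZ.
  have h2 : rnorm (dot (u n - p) g : R[i]^o) <= d * rnorm g.
    apply: le_trans (cauchy_schwarz _ _) _; rewrite ler_wpM2r ?rnorm_ge0//.
    by rewrite rnormB; apply: Nd; exact: leq_maxl.
  have -> : dot (f - p) g = dot (f - u n) g + dot (u n - p) g.
    by rewrite -linearDl addrA subrK.
  by rewrite ed; apply: le_trans (rnormD (_ : R[i]^o) _) _; exact: lerD.
move=> e e0; have [N Ne] := (cvg_rnormP _ _).1 up e e0.
exists (u N); split; first by case: (uP N).
by rewrite (subr0_eq fp); exact: Ne.
Qed.

End Hilbert.

Section Hilbert2.
Context {R : realType} {H : completeNormedModType R[i]}.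
Context {dot : {dot H for @Num.conj R[i]}}.
Hypothesis norm_dot : forall f : H, `|f| ^+ 2 = dot f f.

Lemma pythagoras_sum (I : eqType) (r : seq I) (P : pred I) (F : I -> H) :
  uniq r ->
  (forall i j, i \in r -> j \in r -> P i -> P j -> i != j ->
    dot (F i) (F j) = 0) ->
  rnorm (\sum_(i <- r | P i) F i) ^+ 2 = \sum_(i <- r | P i) rnorm (F i) ^+ 2.
Proof.
elim: r => [|i r IHr] /=; first by rewrite !big_nil rnorm0 expr0n.
move=> /andP[ir ur] Fdot; rewrite !big_cons.
have IH : rnorm (\sum_(j <- r | P j) F j) ^+ 2 = \sum_(j <- r | P j) rnorm (F j) ^+ 2.
  by apply: IHr => // j k jr kr; apply: Fdot; rewrite inE ?jr ?kr orbT.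
case: ifP => // Pi; rewrite (pythagoras norm_dot) ?IH//.
rewrite linear_sumr/= big_seq_cond big1// => j /andP[jr Pj].
apply: Fdot; rewrite ?inE ?eqxx ?jr ?orbT//.
by apply: contraNneq ir => ->.
Qed.

(** Continuous functionals [l] on [K] with [`|l (W h)| <= `|h|] are bounded at
    each [W h], hence uniformly bounded.  Among them are the functionals
    representing, through [W], the inner products against a unit vector [g] of
    [D]; this bounds [dot (V x) g] by [C * `|x|], and [D] is dense because it is
    total. *)
Lemma inverse_continuous (K : completeNormedModType R[i])
    (W : {linear H -> K}) (V : {linear K -> H}) :
  continuous W -> cancel V W -> cancel W V ->
  (forall f : H,
    (forall g (l : {linear K -> R[i]^o}), continuous l ->
      (forall h, dot h g = l (W h)) -> dot f g = 0) -> f = 0) ->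
  continuous V.
Proof.
move=> Wc VK WK total.
pose D : set H := [set g | exists l : {linear K -> R[i]^o},
  continuous l /\ forall h, dot h g = l (W h)].
pose I := {l : {linear K -> R[i]^o} |
  continuous l /\ forall h, rnorm (l (W h)) <= rnorm h}.
have [C C0 lC] : exists2 C, 0 <= C & forall (i : I) x, rnorm (sval i x) <= C * rnorm x.
  have [|x|C lC] := @uniform_boundedness _ _ _ I (fun i => sval i).
  - by case=> l [].
  - exists (rnorm (V x)) => -[l [lc lW]] /=.
    by have := lW (V x); rewrite VK.
  exists `|C| => // i x; apply: le_trans (lC i x) _.
  by rewrite ler_wpM2r ?rnorm_ge0 ?ler_norm.
have Dbound g h : D g -> rnorm (dot h g : R[i]^o) <= C * rnorm (W h) * rnorm g.
  move=> [l [lc lW]]; have [->|g0] := eqVneq g 0.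
    by rewrite linear0r !rnorm0 mulr0.
  have rg0 := rnorm_gt0 g0.
  pose l' : {linear K -> R[i]^o} := ((rnorm g)^-1%:C \*: l)%R.
  have l'E x : rnorm (l' x) = rnorm (l x) / rnorm g.
    by rewrite rnormZ rnormC ger0_norm ?invr_ge0 ?ltW// mulrC.
  have l'I : continuous l' /\ forall h, rnorm (l' (W h)) <= rnorm h.
    split=> [|x].
      have [M lM] := (continuous_rnormP l).1 lc.
      apply/continuous_rnormP; exists (M / rnorm g) => x.
      by rewrite l'E ler_pdivrMr// mulrAC divfK// gt_eqF.
    rewrite l'E ler_pdivrMr// -lW; exact: cauchy_schwarz.
  have := lC (exist _ l' l'I) (W h); rewrite /= l'E ler_pdivrMr// -lW.
  exact.
apply/continuous_rnormP; exists C => x; set f := V x.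
have -> : x = W f by rewrite VK.
have [f0|f0] := eqVneq (rnorm f) 0.
  by rewrite f0 mulr_ge0 ?rnorm_ge0.
have rf0 : 0 < rnorm f by rewrite lt_def f0 rnorm_ge0.
rewrite -(ler_pM2r rf0) -expr2.
apply/ler_addgt0Pr => e e0.
pose b := C * rnorm (W f) + rnorm f.
have b0 : 0 < b by rewrite ltr_wpDl ?mulr_ge0 ?rnorm_ge0.
have [|||||g [Dg gf]] := @total_dense _ _ _ norm_dot D _ _ _ _ f (e / b).
- exists (\0 : {linear K -> R[i]^o}); split; last by move=> h; rewrite linear0r.
  by apply/continuous_rnormP; exists 0 => y; rewrite rnorm0 mul0r.
- move=> g h [l [/continuous_rnormP[M lM] lW]] [l2 [/continuous_rnormP[M2 lM2] lW2]].
  exists (l \+ l2)%R; split=> [|y]; last by rewrite linearDr/= lW lW2.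
  apply/continuous_rnormP; exists (M + M2) => y /=.
  by apply: le_trans (rnormD _ _) _; rewrite mulrDl lerD.
- move=> a g [l [/continuous_rnormP[M lM] lW]].
  exists (Num.conj a \*: l)%R; split=> [|y]; last by rewrite dotZr lW.
  apply/continuous_rnormP; exists (rnorm (Num.conj a : R[i]^o) * M) => y /=.
  by rewrite rnormZ -mulrA ler_wpM2l ?rnorm_ge0.
- move=> h hD; apply: total => g l lc lW; apply: hD.
  by exists l.
- by rewrite divr_gt0.
have -> : rnorm f ^+ 2 = rnorm (dot f g + dot f (f - g) : R[i]^o).
  rewrite -linearDr/= addrC subrK (dot_sqr norm_dot) rnormC ger0_norm//.
  exact: sqr_ge0.
apply: le_trans (rnormD _ _) _.
have gle : rnorm g <= rnorm f + e / b.
  have -> : g = f - (f - g) by rewrite opprB addrC subrK.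
  by apply: le_trans (rnormD _ _) _; rewrite rnormN lerD2l.
have -> : e = C * rnorm (W f) * (e / b) + rnorm f * (e / b).
  by rewrite -mulrDl -/b mulrC divfK// gt_eqF.
rewrite addrA -mulrDr lerD//.
  apply: le_trans (Dbound _ _ Dg) _.
  by rewrite ler_wpM2l ?mulr_ge0 ?rnorm_ge0.
apply: le_trans (cauchy_schwarz norm_dot _ _) _.
by rewrite ler_wpM2l ?rnorm_ge0.
Qed.

End Hilbert2.

(** * Power series on a half-open interval *)

Section Expansions.
Context {R : realType}.
Implicit Types (u v w : nat -> R[i]) (F G P : R -> R[i]).

(** [F] is the sum of the power series [u] on [(0, d]].  Only positive real
    arguments are needed, so that rays [t * v] with [t > 0] suffice. *)
Definition expands (d : R) u F := forall t, 0 < t -> t <= d ->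
  (fun N => \sum_(k < N) u k * t%:C ^+ k : R[i]^o) @ \oo --> (F t : R[i]^o).

Lemma rnormMr (a : R[i]^o) (t : R) : 0 <= t ->
  rnorm (a * t%:C : R[i]^o) = rnorm a * t.
Proof. by move=> t0; rewrite rnormM rnormC ger0_norm. Qed.

Lemma linear_bound_le0 (d C x : R) :
  0 < d -> (forall t, 0 < t -> t <= d -> x <= C * t) -> x <= 0.
Proof.
move=> d0 xC; apply/ler_addgt0Pr => e e0; rewrite add0r.
have C0 : 0 < `|C| + 1 by rewrite ltr_wpDl.
pose t := Order.min d (e / (`|C| + 1)).
have t0 : 0 < t by rewrite lt_min d0 divr_gt0.
have td : t <= d by rewrite ge_min lexx.
apply: le_trans (xC t t0 td) _; apply: (@le_trans _ _ ((`|C| + 1) * t)).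
  by rewrite ler_pM2r//; have := ler_norm C; lra.
by rewrite -ler_pdivlMl// mulrC ge_min lexx orbT.
Qed.

(** The terms at [t = d] are bounded, so that for [t <= d / 2] the tail is
    dominated by [t / d] times a geometric series of ratio [1 / 2]. *)
Lemma expands_near0 (d : R) u F : 0 < d -> expands d u F ->
  exists C, forall t, 0 < t -> t <= d / 2 -> rnorm (F t - u 0%N : R[i]^o) <= C * t.
Proof.
move=> d0 uF; pose a k : R := rnorm (u k * d%:C ^+ k : R[i]^o).
have [M M0 aM] : exists2 M, 0 <= M & forall k, a k <= M.
  have [N SN] := (cvg_rnormP _ _).1 (uF d d0 (lexx _)) 1 ltr01.
  exists (2 + \sum_(k < N) a k).
    by rewrite addr_ge0// sumr_ge0// => k _; exact: rnorm_ge0.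
  move=> k; have [Nk|kN] := leqP N k; last first.
    rewrite (bigD1 (Ordinal kN))//= addrCA lerDl addr_ge0// sumr_ge0// => j _.
    exact: rnorm_ge0.
  apply: (@le_trans _ _ 2); last by rewrite lerDl sumr_ge0// => j _; exact: rnorm_ge0.
  have h1 := SN k Nk; have h2 := SN k.+1 (leqW Nk).
  have -> : a k = rnorm ((F d - \sum_(j < k) u j * d%:C ^+ j) -
     (F d - \sum_(j < k.+1) u j * d%:C ^+ j) : R[i]^o).
    by rewrite /a big_ord_recr/=; congr rnorm; ring.
  apply: le_trans (rnormD _ _) _; rewrite rnormN -[2]/(1 + 1).
  exact: lerD.
exists (M / d * 2) => t t0 td.
have geom N : \sum_(k < N) (2^-1 : R) ^+ k <= 2.
  suff : \sum_(k < N) (2^-1 : R) ^+ k <= 2 - 2 * 2^-1 ^+ N.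
    by move/le_trans; apply; rewrite gerDl oppr_le0 mulr_ge0// exprn_ge0.
  elim: N => [|N IHN]; first by rewrite big_ord0 expr0; lra.
  by rewrite big_ord_recr/= exprS; lra.
have tdn : t <= d by lra.
have td0 : 0 <= t / d by rewrite divr_ge0 ?ltW.
have Mt0 : 0 <= M / d * t by rewrite !mulr_ge0 ?invr_ge0 ?(ltW d0) ?(ltW t0).
have td1 : t / d <= 2^-1 by rewrite ler_pdivrMr// mulrC.
have bound N :
    rnorm (\sum_(k < N.+1) u k * t%:C ^+ k - u 0%N : R[i]^o) <= M / d * 2 * t.
  rewrite big_ord_recl/= expr0 mulr1 addrC addKr.
  apply: le_trans (rnorm_sum _ _ _) _.
  apply: (@le_trans _ _ (\sum_(k < N) M / d * t * 2^-1 ^+ k)); last first.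
    by rewrite -mulr_sumr (mulrAC _ 2) ler_wpM2l.
  apply: ler_sum => k _; rewrite /bump/= add1n.
  have -> : u k.+1 * t%:C ^+ k.+1 = u k.+1 * d%:C ^+ k.+1 * (((t / d) ^+ k.+1)%:C).
    rewrite -mulrA; congr (_ * _); rewrite -!rmorphXn/= -rmorphM/= -exprMn.
    by congr (_%:C); congr (_ ^+ _); field; rewrite gt_eqF.
  rewrite rnormM rnormC ger0_norm ?exprn_ge0//.
  apply: (@le_trans _ _ (M * (t / d) ^+ k.+1)).
    by rewrite ler_wpM2r ?aM ?exprn_ge0.
  rewrite exprS mulrA (_ : M * (t / d) = M / d * t); last by rewrite mulrA mulrAC.
  by rewrite ler_wpM2l// lerXn2r ?nnegrE.
apply/ler_addgt0Pr => e e0.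
have [N NF] := (cvg_rnormP _ _).1 (uF t t0 tdn) e e0.
have := NF N.+1 (leqnSn N); have := bound N.
set S : R[i]^o := \sum_(k < N.+1) _ => h1 h2.
have -> : F t - u 0%N = (S - u 0%N) + (F t - S) by ring.
by apply: le_trans (rnormD (_ : R[i]^o) _) _; exact: lerD.
Qed.

Lemma expands_shift (d : R) u F : expands d u F ->
  expands d (fun k => u k.+1) (fun t => (F t - u 0%N) / t%:C).
Proof.
move=> uF t t0 td; apply/cvg_rnormP => e e0.
have [N NF] := (cvg_rnormP _ _).1 (uF t t0 td) (e * t) (mulr_gt0 e0 t0).
exists N => n Nn; rewrite -(ler_pM2r t0).
have tC0 : t%:C != 0 by rewrite (inj_eq (@complexI _) t 0) gt_eqF.
apply: le_trans (NF n.+1 (leqW Nn)).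
suff -> : F t - \sum_(k < n.+1) u k * t%:C ^+ k =
    ((F t - u 0%N) / t%:C - \sum_(k < n) u k.+1 * t%:C ^+ k) * t%:C.
  by rewrite rnormMr// ltW.
rewrite mulrBl divfK// big_ord_recl/= expr0 mulr1 opprD addrA mulr_suml.
by congr (_ - _); apply: eq_bigr => k _; rewrite -mulrA -exprSr.
Qed.

Lemma expands_lin (d : R) (c : R[i]) u v F G : expands d u F -> expands d v G ->
  expands d (fun k => u k + c * v k) (fun t => F t + c * G t).
Proof.
move=> uF vG t t0 td.
have -> : (fun N => \sum_(k < N) (u k + c * v k) * t%:C ^+ k : R[i]^o) =
  (fun N => \sum_(k < N) u k * t%:C ^+ k + c * \sum_(k < N) v k * t%:C ^+ k : R[i]^o).
  apply/funext => N; rewrite mulr_sumr -big_split/=.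
  by apply: eq_bigr => k _; rewrite mulrDl -mulrA.
by apply: cvgD; [exact: uF|apply: cvgMr; exact: vG].
Qed.

Lemma expands_unique0 (d : R) u F : 0 < d -> expands d u F ->
  (forall t, 0 < t -> t <= d -> F t = 0) -> forall k, u k = 0.
Proof.
move=> d0 + + k; have u0 u' F' : expands d u' F' ->
    (forall t, 0 < t -> t <= d -> F' t = 0) -> u' 0%N = 0.
  move=> uF F0; have [C FC] := expands_near0 d0 uF.
  apply: (@rnorm_eq0 _ R[i]^o); apply/eqP; rewrite eq_le rnorm_ge0 andbT.
  apply: (@linear_bound_le0 (d / 2) C) => [|t t0 td]; first by rewrite divr_gt0.
  have := FC t t0 td; rewrite F0//; last by lra.
  by rewrite sub0r rnormN.
elim: k u F => [|k IHk] u F uF F0; first exact: u0 uF F0.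
apply: (IHk (fun k => u k.+1) _ (expands_shift uF)) => t t0 td.
by rewrite F0// (u0 _ _ uF F0) subr0 mul0r.
Qed.

Lemma expands_unique (d : R) u v F : 0 < d -> expands d u F -> expands d v F ->
  forall k, u k = v k.
Proof.
move=> d0 uF vF k; apply: subr0_eq; rewrite -[- v k]mulN1r.
apply: (expands_unique0 d0 (expands_lin (c := -1) uF vF)) => t _ _.
by rewrite mulN1r subrr.
Qed.

(** Cauchy product without absolute convergence: the expansion [w] of the
    product is given, and its coefficients are found one at a time by letting
    [t] tend to [0] and dividing.  The induction replaces [G] by
    [(G - v 0) / t], whose product with [F] is again expandable. *)
Lemma expands_mul (d : R) u v w F G P : 0 < d ->
  expands d u F -> expands d v G -> expands d w P ->
  (forall t, 0 < t -> t <= d -> P t = F t * G t) ->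
  forall k, w k = \sum_(j < k.+1) u j * v (k - j)%N.
Proof.
move=> d0 uF + + + k.
have w0 v' w' G' P' : expands d v' G' -> expands d w' P' ->
    (forall t, 0 < t -> t <= d -> P' t = F t * G' t) -> w' 0%N = u 0%N * v' 0%N.
  move=> vG wP PFG.
  have [Cu FC] := expands_near0 d0 uF.
  have [Cv GC] := expands_near0 d0 vG.
  have [Cw PC] := expands_near0 d0 wP.
  apply/eqP; rewrite -subr_eq0; apply/eqP; apply: (@rnorm_eq0 _ R[i]^o).
  apply/eqP; rewrite eq_le rnorm_ge0 andbT.
  apply: (@linear_bound_le0 (d / 2) (Cw + Cu * (Cv * (d / 2)) +
    rnorm (u 0%N : R[i]^o) * Cv + Cu * rnorm (v' 0%N : R[i]^o)))
    => [|t t0 td]; first by rewrite divr_gt0.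
  have td' : t <= d by lra.
  have -> : w' 0%N - u 0%N * v' 0%N = - (P' t - w' 0%N) +
      ((F t - u 0%N) * (G' t - v' 0%N) + u 0%N * (G' t - v' 0%N)
       + (F t - u 0%N) * v' 0%N) by rewrite PFG//; ring.
  have hF := FC t t0 td; have hG := GC t t0 td; have hP := PC t t0 td.
  apply: le_trans (rnormD (_ : R[i]^o) _) _; rewrite rnormN.
  apply: (@le_trans _ _ (Cw * t + (Cu * t * (Cv * t) +
     rnorm (u 0%N : R[i]^o) * (Cv * t) + Cu * t * rnorm (v' 0%N : R[i]^o)))).
    apply: lerD => //; apply: le_trans (rnormD (_ : R[i]^o) _) _.
    apply: lerD; last by rewrite rnormM ler_wpM2r ?rnorm_ge0.
    apply: le_trans (rnormD (_ : R[i]^o) _) _.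
    apply: lerD; last by rewrite rnormM ler_wpM2l ?rnorm_ge0.
    by rewrite rnormM ler_pM ?rnorm_ge0.
  have Cu0 : 0 <= Cu.
    by rewrite -(pmulr_lge0 _ t0); apply: le_trans hF; exact: rnorm_ge0.
  have Cv0 : 0 <= Cv.
    by rewrite -(pmulr_lge0 _ t0); apply: le_trans hG; exact: rnorm_ge0.
  have : Cu * Cv * t * t <= Cu * Cv * t * (d / 2).
    by rewrite ler_wpM2l// !mulr_ge0// ltW.
  by move: (rnorm _) (rnorm _) => x y; lra.
elim: k v w G P => [|k IHk] v w G P vG wP PFG.
  by rewrite big_ord_recl big_ord0 addr0; exact: (w0 _ _ _ _ vG wP PFG).
have w00 := w0 _ _ _ _ vG wP PFG.
have := IHk _ _ _ _ (expands_shift vG)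
  (expands_lin (c := - v 0%N) (expands_shift wP) (expands_shift uF)).
rewrite /= => IH; rewrite big_ord_recr/= subnn.
have -> : \sum_(j < k.+1) u j * v (k.+1 - j)%N = \sum_(j < k.+1) u j * v (k - j).+1.
  by apply: eq_bigr => j _; rewrite subSn// -ltnS.
rewrite -IH; first by rewrite mulNr [u k.+1 * _]mulrC subrK.
move=> t t0 td; rewrite PFG// w00; field.
by rewrite (inj_eq (@complexI _) t 0) gt_eqF.
Qed.

End Expansions.

(** * Orthogonal expansion along the monomials *)

Section Monomials.
Context {d : nat}.

(** Multi-indices of degree [n] have entries at most [n], so that sums over them
    range over this finite box, filtered by degree. *)
Definition of_box n (be : {ffun 'I_d -> 'I_n.+1}) : multiindex d :=
  [ffun i => be i : nat].

Lemma of_box_inj n : injective (@of_box n).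
Proof.
move=> be ga /ffunP bega; apply/ffunP => i; apply/val_inj.
by have := bega i; rewrite !ffunE.
Qed.

Lemma leq_mdeg (al : multiindex d) i : (al i <= mdeg al)%N.
Proof. by rewrite /mdeg (bigD1 i)//= leq_addr. Qed.

Lemma of_box_onto n (al : multiindex d) : (mdeg al <= n)%N ->
  exists be : {ffun 'I_d -> 'I_n.+1}, of_box be = al.
Proof.
move=> aln; exists [ffun i => inord (al i)]; apply/ffunP => i.
by rewrite !ffunE inordK// ltnS; apply: leq_trans aln; exact: leq_mdeg.
Qed.

Definition axis (i0 : 'I_d) (n : nat) : multiindex d :=
  [ffun i => if i == i0 then n else 0%N].

Lemma mdeg_axis i0 n : mdeg (axis i0 n) = n.
Proof.
rewrite /mdeg (bigD1 i0)//= big1 ?addn0 ?ffunE ?eqxx// => i ii0.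
by rewrite ffunE (negbTE ii0).
Qed.

End Monomials.

Section Fourier.
Context {R : realType} {d : nat} {X : set 'rV[R[i]]_d}.
Context {H : hilbert_function_space R X} (m : multiindex d -> H).
Hypothesis wm : weighted_monomials m.

(** [coef al f] is the coefficient of the monomial [z ^ al] in the orthogonal
    expansion of [f]; it plays the role of the Taylor coefficient at [0]. *)
Definition coef (al : multiindex d) (f : H) : R[i]^o :=
  hfs_dot f (m al) / hfs_dot (m al) (m al).

Lemma coef_linear al : linear (coef al).
Proof. by move=> a f g; rewrite /coef linearDl/= dotZl mulrDl -mulrA. Qed.

HB.instance Definition _ al :=
  GRing.isLinear.Build R[i] H R[i]^o *:%R (coef al) (@coef_linear al).

Lemma monomial_neq0 al : m al != 0.
Proof. by case: wm. Qed.

Lemma dot_monomial_neq0 al : hfs_dot (m al) (m al) != 0.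
Proof. by rewrite dnorm_eq0 monomial_neq0. Qed.

Lemma rnorm_monomial_gt0 al : 0 < rnorm (m al).
Proof. exact/rnorm_gt0/monomial_neq0. Qed.

Lemma dot_monomials al be : al != be -> hfs_dot (m al) (m be) = 0.
Proof. by case: wm => _ _ + _ _; apply. Qed.

Lemma coef_monomial al be : coef al (m be) = (al == be)%:R.
Proof.
rewrite /coef; have [->|ab] := eqVneq; first by rewrite divff ?dot_monomial_neq0.
by rewrite dot_monomials ?mul0r// eq_sym.
Qed.

Lemma coef_dot al f : hfs_dot f (m al) = coef al f * hfs_dot (m al) (m al).
Proof. by rewrite divfK ?dot_monomial_neq0. Qed.

Lemma coef_bound al f : rnorm (coef al f) * rnorm (m al) <= rnorm f.
Proof.
rewrite -(ler_pM2r (rnorm_monomial_gt0 al)) -mulrA -expr2.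
apply: le_trans (cauchy_schwarz (@hfs_norm_dot _ _ H) _ _).
rewrite coef_dot rnormM (dot_sqr (@hfs_norm_dot _ _ H)) rnormC ger0_norm//.
exact: sqr_ge0.
Qed.

Lemma rnorm_coef_le al f : rnorm (coef al f) <= (rnorm (m al))^-1 * rnorm f.
Proof. by rewrite ler_pdivlMl ?rnorm_monomial_gt0// mulrC coef_bound. Qed.

Lemma coef_continuous al : continuous (coef al).
Proof.
apply/(continuous_rnormP (coef al)); exists (rnorm (m al))^-1.
exact: rnorm_coef_le.
Qed.

Definition homog n (f : H) : H :=
  \sum_(be : {ffun 'I_d -> 'I_n.+1} | mdeg (of_box be) == n)
    coef (of_box be) f *: m (of_box be).

Definition partial N (f : H) : H := \sum_(n < N) homog n f.

Lemma partial_linear N : linear (partial N).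
Proof.
move=> a f g; rewrite /partial scaler_sumr -big_split/=; apply: eq_bigr => n _.
rewrite /homog scaler_sumr -big_split/=; apply: eq_bigr => be _.
by rewrite linearP scalerDl scalerA.
Qed.

HB.instance Definition _ N :=
  GRing.isLinear.Build R[i] H H *:%R (partial N) (@partial_linear N).

Lemma sum_box_single (V : zmodType) n al (F : multiindex d -> V) :
  (forall be, mdeg be = n -> be != al -> F be = 0) ->
  \sum_(be : {ffun 'I_d -> 'I_n.+1} | mdeg (of_box be) == n) F (of_box be) =
  if mdeg al == n then F al else 0.
Proof.
move=> F0; case: ifPn => [/eqP aln|aln].
  have [be beal] : exists be : {ffun 'I_d -> 'I_n.+1}, of_box be = al.
    by apply: of_box_onto; rewrite aln.
  rewrite (bigD1 be)/= ?beal ?aln// big1 ?addr0// => ga /andP[/eqP gan gabe].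
  by apply: F0 => //; rewrite -beal (inj_eq (@of_box_inj d n)).
rewrite big1// => be /eqP ben; apply: F0 => //.
by apply: contraNneq aln => <-; rewrite ben.
Qed.

Lemma dot_homog n f al :
  hfs_dot (homog n f) (m al) = if mdeg al == n then hfs_dot f (m al) else 0.
Proof.
rewrite linear_sumlz/=.
rewrite (@sum_box_single R[i] n al (fun be => hfs_dot (coef be f *: m be) (m al))).
  by case: ifP => // _; rewrite dotZl -coef_dot.
by move=> be _ beal; rewrite dotZl dot_monomials// mulr0.
Qed.

Lemma dot_partial N f al :
  hfs_dot (partial N f) (m al) = if (mdeg al < N)%N then hfs_dot f (m al) else 0.
Proof.
rewrite linear_sumlz/=; under eq_bigr do rewrite dot_homog.
case: ifPn => aN.
  rewrite (bigD1 (Ordinal aN))//= eqxx big1 ?addr0// => n.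
  by rewrite -val_eqE/= eq_sym => /negbTE ->.
rewrite big1// => n _; case: eqP => // aln.
by move: aN; rewrite aln ltn_ord.
Qed.

Lemma coef_partial N f al : (mdeg al < N)%N -> coef al (partial N f) = coef al f.
Proof. by move=> aN; rewrite /coef dot_partial aN. Qed.

Lemma coef_inj f g : (forall al, coef al f = coef al g) -> f = g.
Proof.
move=> fg; apply: subr0_eq; case: wm => _ _ _ + _; apply => al.
by rewrite linearBl/= (coef_dot al f) (coef_dot al g) fg subrr.
Qed.

Lemma dot_partial_perp N f g :
  (forall al, (mdeg al < N)%N -> hfs_dot f (m al) = 0) -> hfs_dot f (partial N g) = 0.
Proof.
move=> f0; rewrite linear_sumr/= big1// => n _.
rewrite linear_sumr/= big1// => be /eqP ben.
by rewrite dotZr f0 ?mulr0// ben.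
Qed.

(** [partial N] is the orthogonal projection onto the polynomials of degree
    less than [N]. *)
Lemma partial_best N f g : partial N g = g ->
  rnorm (f - partial N f) <= rnorm (f - g).
Proof.
move=> gN; rewrite -(@ler_pXn2r _ 2)// ?nnegrE ?rnorm_ge0//.
have -> : f - g = (f - partial N f) + partial N (f - g).
  by rewrite linearB/= gN addrA subrK.
rewrite [leRHS](pythagoras (@hfs_norm_dot _ _ H)) ?lerDl ?sqr_ge0//.
apply: dot_partial_perp => al aN.
by rewrite linearBl/= dot_partial aN subrr.
Qed.

Lemma partial_monomial N al : (mdeg al < N)%N -> partial N (m al) = m al.
Proof.
move=> aN; apply: coef_inj => be; have [->|ab] := eqVneq be al.
  by rewrite coef_partial.
rewrite /coef dot_partial; case: ifP => // _.
by rewrite (@dot_monomials al be)// eq_sym.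
Qed.

Lemma partial_cvg f : (fun N => partial N f) @ \oo --> f.
Proof.
pose D : set H := [set g | exists N, forall M, (N <= M)%N -> partial M g = g].
apply/cvg_rnormP => e e0.
have [|||||g [[N gN] ge]] := @total_dense _ _ _ (@hfs_norm_dot _ _ H) D _ _ _ _ f e.
- by exists 0%N => M _; rewrite linear0.
- move=> g h [N gN] [P hP]; exists (maxn N P) => M; rewrite geq_max => /andP[NM PM].
  by rewrite linearD/= gN ?hP.
- by move=> a g [N gN]; exists N => M NM; rewrite linearZ/= gN.
- move=> g gD; case: wm => _ _ _ + _; apply => al; apply: gD.
  by exists (mdeg al).+1 => M; exact: partial_monomial.
- by [].
by exists N => M NM; apply: le_trans ge; apply: partial_best; exact: gN.
Qed.

Lemma continuous_seq (V W : normedModType R[i]) (s : V -> W) (u : V^nat) l :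
  continuous s -> u @ \oo --> l -> (s \o u) @ \oo --> s l.
Proof. by move=> sc ul; apply: cvg_comp ul (sc l). Qed.

Lemma monomials_total (s : {linear H -> R[i]^o}) : continuous s ->
  (forall al, s (m al) = 0) -> forall f, s f = 0.
Proof.
move=> sc s0 f; have := continuous_seq sc (@partial_cvg f).
rewrite (_ : s \o _ = cst 0).
  by move=> /cvg_lim <-//; rewrite lim_cst.
apply/funext => N /=; rewrite linear_sum big1// => n _.
by rewrite linear_sum big1// => be _; rewrite linearZ/= s0 scaler0.
Qed.

End Fourier.

(** * Natural domains and rays through the origin *)

Section Domain.
Context {R : realType} {d : nat}.
Implicit Types (v : 'rV[R[i]]_d) (a : R^nat).

Lemma cdot_sqr v :
  cdot v v = (\sum_(i < d) (complex.Re (v ord0 i) ^+ 2 +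
                           complex.Im (v ord0 i) ^+ 2))%:C.
Proof.
by rewrite /cdot rmorph_sum/=; apply: eq_bigr => i _; rewrite add_Re2_Im2 sqr_normc.
Qed.

Lemma cdot_cnorm v : cdot v v = (cnorm v ^+ 2)%:C.
Proof.
by rewrite /cnorm cdot_sqr/= sqr_sqrtr// sumr_ge0// => i _; rewrite addr_ge0 ?sqr_ge0.
Qed.

Lemma cnorm_ge0 v : 0 <= cnorm v. Proof. exact: sqrtr_ge0. Qed.

Lemma cnorm_scale (t : R) v : 0 <= t -> cnorm (t%:C *: v) = t * cnorm v.
Proof.
move=> t0; rewrite /cnorm !cdot_sqr/= -[X in _ = X * _](ger0_norm t0).
rewrite -sqrtr_sqr -sqrtrM ?sqr_ge0//.
congr Num.sqrt; rewrite mulr_sumr; apply: eq_bigr => i _; rewrite !mxE.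
by case: (v ord0 i) => x y /=; ring.
Qed.

Lemma oball_natural_domain a : oball (ball_radius a) `<=` @natural_domain R d a.
Proof. by move=> v va; rewrite /natural_domain; case: ifP => // _; exact: ltW. Qed.

Lemma small_natural_domain a v : generating_function a ->
  exists2 s : R, 0 < s & forall t, 0 < t -> t <= s -> natural_domain a (t%:C *: v).
Proof.
move=> [_ _ cr0].
have [r r0 ra] : exists2 r : R, 0 < r & (r%:E <= ball_radius a)%E.
  rewrite /ball_radius; case: (convergence_radius a) cr0 => [c|_|//].
    by rewrite lte_fin => c0; exists (Num.sqrt c); rewrite ?sqrtr_gt0.
  by exists 1 => //; rewrite leey.
have v0 : 0 < cnorm v + 1 by rewrite ltr_wpDl ?cnorm_ge0.
exists (r / (cnorm v + 1)); first by rewrite divr_gt0.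
move=> t t0 ts; apply: oball_natural_domain; apply: lt_le_trans ra.
rewrite lte_fin cnorm_scale ?(ltW t0)//.
move: ts; rewrite ler_pdivlMr//; apply: lt_le_trans.
by rewrite ltr_pM2l// ltrDl.
Qed.

(** On the boundary sphere the definition of the natural domain asks for the
    convergence of the series, which is the hypothesis. *)
Lemma mem_natural_domain a v : generating_function a ->
  cvgn (pseries a (cnorm v ^+ 2)) -> natural_domain a v.
Proof.
move=> [_ _ cr0] cv.
have ler : ((cnorm v ^+ 2)%:E <= convergence_radius a)%E.
  rewrite -(ger0_norm (sqr_ge0 (cnorm v))).
  by apply: ereal_sup_ubound; exists (cnorm v ^+ 2).
have le : ((cnorm v)%:E <= ball_radius a)%E.
  rewrite /ball_radius; case: (convergence_radius a) cr0 ler => [c|_ _|//].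
    rewrite lte_fin !lee_fin /= => c0 vc.
    by rewrite -(ger0_norm (cnorm_ge0 v)) -sqrtr_sqr ler_wsqrtr.
  by rewrite leey.
rewrite /natural_domain; case: asboolP => // nconv.
rewrite /oball /= lt_neqAle le andbT; apply/eqP => vr; apply: nconv.
by rewrite -vr ltry.
Qed.

End Domain.

Section Ray.
Context {R : realType} {d : nat} {X : set 'rV[R[i]]_d}.
Context {H : hilbert_function_space R X} {m : multiindex d -> H}.
Hypothesis wm : weighted_monomials m.

Lemma monomialE al (x : X) : hfs_fun (m al) x = monomial al (val x).
Proof. by case: wm. Qed.

Lemma monomial_scale (al : multiindex d) (c : R[i]) v :
  monomial al (c *: v) = c ^+ mdeg al * monomial al v.
Proof.
rewrite /monomial /mdeg -prodrXr -big_split/=; apply: eq_bigr => i _.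
by rewrite mxE exprMn.
Qed.

Lemma monomial_axis i0 n : monomial (axis i0 n) (delta_mx 0 i0 : 'rV[R[i]]_d) = 1.
Proof.
rewrite /monomial big1// => i _; rewrite mxE ffunE eqxx/=.
by case: eqP; rewrite ?expr0 ?expr1n.
Qed.

Lemma monomial_off_axis i0 (al : multiindex d) : al != axis i0 (mdeg al) ->
  monomial al (delta_mx 0 i0 : 'rV[R[i]]_d) = 0.
Proof.
move=> aln; have [i ii0 ai] : exists2 i, i != i0 & (0 < al i)%N.
  apply: contrapT => noi; move/eqP: aln; apply; apply/ffunP => i.
  have al0 j : j != i0 -> al j = 0%N.
    move=> ji0; apply/eqP; rewrite -leqn0 leqNgt; apply/negP => aj.
    by apply: noi; exists j.
  rewrite ffunE; case: eqP => [->|/eqP/al0//].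
  by rewrite /mdeg (bigD1 i0)//= big1 ?addn0// => j /al0.
rewrite /monomial (bigD1 i)//= mxE eqxx (negbTE ii0) expr0n.
by rewrite eqn0Ngt ai mul0r.
Qed.

Lemma fun_homog n f (x : X) :
  hfs_fun (homog m n f) x =
  \sum_(be : {ffun 'I_d -> 'I_n.+1} | mdeg (of_box be) == n)
    coef m (of_box be) f * monomial (of_box be) (val x).
Proof.
rewrite /homog (linear_sum (@hfs_fun R X H)) fct_sumE.
by apply: eq_bigr => be _; rewrite linearZ/= -monomialE.
Qed.

(** On the ray [t * e_i0] every monomial vanishes except the powers of
    [z_i0]. *)
Lemma ray_expands i0 (s : R) (p : R -> X) :
  (forall t, 0 < t -> t <= s -> val (p t) = t%:C *: delta_mx 0 i0) ->
  forall f : H, expands s (fun n => coef m (axis i0 n) f) (fun t => hfs_fun f (p t)).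
Proof.
move=> pE f t t0 ts.
have := continuous_seq (@hfs_eval_continuous _ _ H (p t)) (@partial_cvg _ _ _ _ _ wm f).
suff -> : (fun N => \sum_(k < N) coef m (axis i0 k) f * t%:C ^+ k : R[i]^o) =
  (fun g : H => hfs_fun g (p t)) \o (fun N => partial m N f) by [].
apply/funext => N /=; rewrite (linear_sum (@hfs_fun R X H)) fct_sumE.
apply: eq_bigr => n _; rewrite fun_homog pE//.
rewrite (@sum_box_single d R[i] n (axis i0 n)
  (fun be => coef m be f * monomial be (t%:C *: delta_mx 0 i0))).
  by rewrite mdeg_axis eqxx monomial_scale monomial_axis mdeg_axis mulr1.
move=> be ben bea; rewrite monomial_scale monomial_off_axis ?mulr0//.
by rewrite ben.
Qed.

End Ray.

(** * Multipliers and growth of the monomials *)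

Lemma linear_mapP (K : pzRingType) (V W : lmodType K) (f : V -> W) : linear f ->
  exists g : {linear V -> W}, g =1 f.
Proof.
move=> lf; pose g : {linear V -> W} := HB.pack f (GRing.isLinear.Build _ _ _ _ _ lf).
by exists g.
Qed.

Section Multiplication.
Context {R : realType} {d : nat} {X : set 'rV[R[i]]_d}.
Context {H : hilbert_function_space R X}.

Lemma multiplication_operator (q : X -> R[i]) : multiplier H q ->
  exists M : {linear H -> H}, forall f x, hfs_fun (M f) x = q x * hfs_fun f x.
Proof.
move=> /choice[M0 M0E].
have [|M ME] := @linear_mapP _ H H M0.
  move=> c f g; apply: (@hfs_fun_inj _ _ H); apply/funext => x.
  rewrite linearP !fctE M0E linearP !fctE !M0E.
  by rewrite mulrDr mulrCA.
by exists M => f x; rewrite ME.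
Qed.

Context {a : R^nat} {m : multiindex d -> H}.
Hypothesis ga : generating_function a.
Hypothesis Xa : X = natural_domain a.
Hypothesis wm : weighted_monomials m.

Lemma ray_exists (v : 'rV[R[i]]_d) : exists (s : R) (p : R -> X), 0 < s /\
  forall t, 0 < t -> t <= s -> val (p t) = t%:C *: v.
Proof.
have [s s0 sX] := small_natural_domain v ga.
have memX t : 0 < t -> t <= s -> t%:C *: v \in X.
  by move=> t0 ts; rewrite Xa; apply/mem_set/sX.
have /choice[p pE] t : exists x : X, 0 < t -> t <= s -> val x = t%:C *: v.
  pose x0 : X := exist (fun z => z \in X) _ (memX s s0 (lexx _)).
  have [t0|t0] := ltP 0 t; last by exists x0.
  have [ts|ts] := leP t s; last by exists x0.
  by exists (exist (fun z => z \in X) _ (memX t t0 ts)).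
by exists s, p.
Qed.

Lemma coef_product i0 (f g h : H) : is_product f g h -> forall n,
  coef m (axis i0 n) h =
  \sum_(j < n.+1) coef m (axis i0 j) f * coef m (axis i0 (n - j)%N) g.
Proof.
move=> fgh n; have [s [p [s0 pE]]] := ray_exists (delta_mx 0 i0).
have ray := ray_expands wm pE.
by apply: (expands_mul s0 (ray f) (ray g) (ray h)) => t _ _; exact: fgh.
Qed.

(** The coefficients of index [0] and [1] behave as the value and the derivative
    at the origin: the latter obeys the Leibniz rule. *)
Lemma coef0_product i0 (f g h : H) : is_product f g h ->
  coef m (axis i0 0) h = coef m (axis i0 0) f * coef m (axis i0 0) g.
Proof. by move=> fgh; rewrite (coef_product i0 fgh) big_ord_recl big_ord0 addr0. Qed.

Lemma coef1_product i0 (f g h : H) : is_product f g h ->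
  coef m (axis i0 1) h = coef m (axis i0 0) f * coef m (axis i0 1) g
    + coef m (axis i0 1) f * coef m (axis i0 0) g.
Proof. by move=> fgh; rewrite (coef_product i0 fgh) !big_ord_recl big_ord0 addr0. Qed.

Lemma axis_eq i0 n k : (axis i0 n == axis i0 k :> multiindex d) = (n == k).
Proof.
apply/eqP/eqP => [/(congr1 (@mdeg d))|->//]; by rewrite !mdeg_axis.
Qed.

(** The functionals [f |-> `|z^(n+1)| * coef (n+1) (P * f)], where [z] is the
    coordinate [i0], are bounded at [f] by [`|P * f|], and continuous since the
    coefficient of a product is a finite sum.  A common bound applied to
    [f = z^n] gives the claim, as the coefficient of [z^(n+1)] in [P * z^n] is
    the first-order coefficient of [P]. *)
Lemma multiplier_growth i0 (P : H) :
  multiplier H (hfs_fun P) -> coef m (axis i0 1) P != 0 ->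
  exists2 C, 0 <= C & forall n, rnorm (m (axis i0 n.+1)) <= C * rnorm (m (axis i0 n)).
Proof.
move=> /multiplication_operator[M ME] P1.
pose l n : {linear H -> R[i]^o} :=
  ((rnorm (m (axis i0 n.+1)))%:C \*: (coef m (axis i0 n.+1) \o M))%R.
have lE n f : rnorm (l n f) =
    rnorm (coef m (axis i0 n.+1) (M f)) * rnorm (m (axis i0 n.+1)).
  by rewrite rnormZ rnormC ger0_norm ?rnorm_ge0// mulrC.
have ME' f : is_product P f (M f) by move=> x; rewrite ME.
have [n|f|C lC] := @uniform_boundedness _ _ _ nat l.
- apply/continuous_rnormP.
  exists ((\sum_(j < n.+2) rnorm (coef m (axis i0 j) P) *
    (rnorm (m (axis i0 (n.+1 - j)%N)))^-1) * rnorm (m (axis i0 n.+1))) => f.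
  rewrite lE mulrAC ler_wpM2r ?rnorm_ge0// (coef_product i0 (ME' f)).
  apply: le_trans (rnorm_sum _ _ _) _; rewrite mulr_suml; apply: ler_sum => j _.
  by rewrite rnormM -mulrA ler_wpM2l ?rnorm_ge0 ?rnorm_coef_le.
- by exists (rnorm (M f)) => n; rewrite lE coef_bound.
have P10 : 0 < rnorm (coef m (axis i0 1) P) by exact: rnorm_gt0.
exists (`|C| / rnorm (coef m (axis i0 1) P)) => [|n].
  by rewrite divr_ge0 ?rnorm_ge0.
rewrite mulrAC ler_pdivlMr// mulrC.
apply: (@le_trans _ _ (C * rnorm (m (axis i0 n)))); last first.
  by rewrite ler_wpM2r ?rnorm_ge0 ?ler_norm.
apply: le_trans (lC n (m (axis i0 n))); rewrite lE.
suff -> : coef m (axis i0 n.+1) (M (m (axis i0 n))) = coef m (axis i0 1) P by [].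
rewrite (coef_product i0 (ME' _)) big_ord_recl big_ord_recl/= big1 ?addr0.
  rewrite !coef_monomial// !axis_eq subn0 subSS subn0 eqxx mulr1.
  by rewrite gtn_eqF// mulr0 add0r.
move=> j _; rewrite coef_monomial// axis_eq /bump/= !add1n subSS.
by rewrite ltn_eqF ?mulr0// ltn_subrL (leq_ltn_trans _ (ltn_ord j)).
Qed.

End Multiplication.

Lemma cvg_scalar_unique (R : realType) (u : nat -> R[i]^o) (l l' : R[i]^o) :
  u @ \oo --> l -> u @ \oo --> l' -> l = l'.
Proof. exact: (cvg_unique (@norm_hausdorff _ R[i]^o)). Qed.

Section Coordinate.
Context {R : realType} {d : nat} {X : set 'rV[R[i]]_d}.
Context {H : hilbert_function_space R X}.
Context {m : multiindex d -> H}.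
Hypothesis wm : weighted_monomials m.

(** Multiplication by [z_i] sends [z ^ al] to [z ^ raise i al]. *)
Definition raise (i : 'I_d) (al : multiindex d) : multiindex d :=
  [ffun j => (al j + (j == i))%N].

Lemma raise_inj i : injective (raise i).
Proof.
move=> al be /ffunP eab; apply/ffunP => j.
by have := eab j; rewrite !ffunE => /addIn.
Qed.

Lemma mdeg_raise i al : mdeg (raise i al) = (mdeg al).+1.
Proof.
rewrite /mdeg (eq_bigr (fun j => al j + (j == i))%N) => [|j _]; last by rewrite ffunE.
rewrite big_split/= -addn1; congr (_ + _)%N.
by rewrite (bigD1 i)//= eqxx big1// => j /negbTE ->.
Qed.

Lemma mfact_raise i al : mfact (raise i al) = ((al i).+1 * mfact al)%N.
Proof.
rewrite /mfact (bigD1 i)//= ffunE eqxx addn1 factS [in RHS](bigD1 i)//= mulnA.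
by congr (_ * _)%N; apply: eq_bigr => j /negbTE ji; rewrite ffunE ji addn0.
Qed.

Lemma monomial_raise i al (v : 'rV[R[i]]_d) :
  monomial (raise i al) v = v ord0 i * monomial al v.
Proof.
rewrite /monomial (bigD1 i)//= ffunE eqxx addn1 exprS [in RHS](bigD1 i)//= mulrA.
by congr (_ * _); apply: eq_bigr => j /negbTE ji; rewrite ffunE ji addn0.
Qed.

Lemma mfact_axis i0 n : mfact (axis i0 n : multiindex d) = n`!.
Proof.
rewrite /mfact (bigD1 i0)//= ffunE eqxx big1 ?muln1// => j /negbTE ji.
by rewrite ffunE ji.
Qed.

Lemma mfact_gt0 (al : multiindex d) : (0 < mfact al)%N.
Proof. by rewrite /mfact prodn_gt0// => i; exact: fact_gt0. Qed.

Lemma monomial_norm i0 al :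
  rnorm (m al) ^+ 2 =
  rnorm (m (axis i0 (mdeg al))) ^+ 2 * (mfact al)%:R / (mdeg al)`!%:R.
Proof.
case: wm => _ _ _ _ [+ _] => /(_ al (axis i0 (mdeg al))).
rewrite mdeg_axis mfact_axis !rnormE -!rmorphXn/= => /(_ erefl).
rewrite -!(rmorph_nat (real_complex R)) -!fmorphV -!rmorphM => /complexI E.
have f0 : (mfact al)%:R != 0 :> R by rewrite pnatr_eq0 -lt0n mfact_gt0.
have -> : rnorm (m al) ^+ 2 = rnorm (m al) ^+ 2 / (mfact al)%:R * (mfact al)%:R.
  by rewrite divfK.
by rewrite E mulrAC.
Qed.

(** By [monomial_norm], [`|z_i z^al|^2 / `|z^al|^2] is [(al i + 1) / (n + 1)]
    times [`|z_i0^(n+1)|^2 / `|z_i0^n|^2], where [n] is the degree of [al]; the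
    factor is at most [1]. *)
Lemma raise_growth i0 C : 0 <= C ->
  (forall n, rnorm (m (axis i0 n.+1)) <= C * rnorm (m (axis i0 n))) ->
  forall i al, rnorm (m (raise i al)) <= C * rnorm (m al).
Proof.
move=> C0 mC i al.
rewrite -(@ler_pXn2r _ 2)// ?nnegrE ?mulr_ge0 ?rnorm_ge0// exprMn.
rewrite (monomial_norm i0 (raise i al)) (monomial_norm i0 al).
rewrite mdeg_raise mfact_raise factS !natrM.
set n := mdeg al; set M : R := (mfact al)%:R; set N : R := n`!%:R.
have N0 : 0 < N by rewrite ltr0n fact_gt0.
have M0 : 0 <= M by rewrite ler0n.
have n0 : 0 < n.+1%:R :> R by rewrite ltr0n.
have ain : (al i).+1%:R <= n.+1%:R :> R by rewrite ler_nat ltnS leq_mdeg.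
have mn : rnorm (m (axis i0 n.+1)) ^+ 2 <= C ^+ 2 * rnorm (m (axis i0 n)) ^+ 2.
  by rewrite -exprMn lerXn2r ?nnegrE ?mulr_ge0 ?rnorm_ge0.
have MN0 : 0 <= M / N by rewrite divr_ge0// ltW.
have -> : rnorm (m (axis i0 n.+1)) ^+ 2 * ((al i).+1%:R * M) / (n.+1%:R * N) =
    rnorm (m (axis i0 n.+1)) ^+ 2 * (M / N) * ((al i).+1%:R / n.+1%:R).
  by field; rewrite !gt_eqF.
apply: (@le_trans _ _ (rnorm (m (axis i0 n.+1)) ^+ 2 * (M / N) * 1)).
  apply: ler_wpM2l; first by rewrite mulr_ge0// sqr_ge0.
  by rewrite ler_pdivrMr// mul1r.
by rewrite mulr1 -[_ * M / N]mulrA [leRHS]mulrA ler_wpM2r.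
Qed.

Lemma pythagoras_box (kap : multiindex d -> multiindex d)
    (v : multiindex d -> R[i]) N M :
  injective kap ->
  rnorm (\sum_(N <= n < M) \sum_(be : {ffun 'I_d -> 'I_n.+1} | mdeg (of_box be) == n)
    v (of_box be) *: m (kap (of_box be))) ^+ 2 =
  \sum_(N <= n < M) \sum_(be : {ffun 'I_d -> 'I_n.+1} | mdeg (of_box be) == n)
    (rnorm (v (of_box be) : R[i]^o) * rnorm (m (kap (of_box be)))) ^+ 2.
Proof.
move=> kap_inj; rewrite (pythagoras_sum (@hfs_norm_dot _ _ H)) ?iota_uniq//; last first.
  move=> n p _ _ _ _ np; rewrite linear_sumlz/= big1// => be /eqP ben.
  rewrite linear_sumr/= big1// => ga /eqP gap.
  rewrite dotZl dotZr (dot_monomials wm) ?mulr0//.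
  by rewrite (inj_eq kap_inj); apply: contraNneq np => bega; rewrite -ben -gap bega.
apply: eq_bigr => n _; rewrite (pythagoras_sum (@hfs_norm_dot _ _ H)).
- by apply: eq_bigr => be _; rewrite rnormZ.
- exact: index_enum_uniq.
move=> be ga _ _ _ _ bega; rewrite dotZl dotZr (dot_monomials wm) ?mulr0//.
by rewrite (inj_eq kap_inj) (inj_eq (@of_box_inj d n)).
Qed.

(** The shifted partial sums of [f] stay mutually orthogonal and grow by a factor
    at most [C], so they converge; pointwise, their limit is [z_i * f]. *)
Lemma coordinate_multiplication i0 C : 0 <= C ->
  (forall n, rnorm (m (axis i0 n.+1)) <= C * rnorm (m (axis i0 n))) ->
  forall i, exists2 Z : {linear H -> H}, continuous Z &
    forall f x, hfs_fun (Z f) x = val x ord0 i * hfs_fun f x.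
Proof.
move=> C0 mC i; have growth := raise_growth C0 mC.
pose w f n : H := \sum_(be : {ffun 'I_d -> 'I_n.+1} | mdeg (of_box be) == n)
  coef m (of_box be) f *: m (raise i (of_box be)).
pose u f N : H := \sum_(n < N) w f n.
have uE f N x : hfs_fun (u f N) x = val x ord0 i * hfs_fun (partial m N f) x.
  rewrite !(linear_sum (@hfs_fun R X H)) !fct_sumE mulr_sumr; apply: eq_bigr => n _.
  rewrite !(linear_sum (@hfs_fun R X H)) !fct_sumE mulr_sumr; apply: eq_bigr => be _.
  by rewrite !linearZ/= !fctE !(monomialE wm) monomial_raise mulrCA.
have ule f N M : (N <= M)%N ->
    rnorm (u f M - u f N) <= C * rnorm (partial m M f - partial m N f).
  move=> NM.
  have tele (F : nat -> H) :
      \sum_(n < M) F n - \sum_(n < N) F n = \sum_(N <= n < M) F n.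
    apply/eqP; rewrite subr_eq addrC -!(big_mkord predT F); apply/eqP.
    by rewrite -big_cat_nat.
  rewrite /u /partial (tele (w f)) (tele (fun n => homog m n f)).
  rewrite -(@ler_pXn2r _ 2)// ?nnegrE ?mulr_ge0 ?rnorm_ge0//.
  rewrite exprMn (pythagoras_box (fun be => coef m be f) _ _ (@raise_inj i)).
  rewrite (pythagoras_box (fun be => coef m be f) _ _ (@inj_id _)) mulr_sumr.
  apply: ler_sum => n _.
  rewrite mulr_sumr; apply: ler_sum => be _.
  rewrite -exprMn lerXn2r ?nnegrE ?mulr_ge0 ?rnorm_ge0//.
  by rewrite mulrCA ler_wpM2l ?rnorm_ge0.
have ucvg f : exists g : H, u f @ \oo --> g.
  apply: cauchy_rnorm_cvg => e e0.
  have C1 : 0 < C + 1 by rewrite ltr_wpDl.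
  have [N Nf] := (cvg_rnormP _ _).1 (@partial_cvg _ _ _ _ _ wm f) _
    (divr_gt0 (divr_gt0 e0 (ltr0Sn _ 1)) C1).
  have close n p : (N <= n)%N -> (n <= p)%N -> rnorm (u f p - u f n) <= e.
    move=> Nn np; apply: le_trans (ule f n p np) _.
    have := Nf n Nn; have := Nf p (leq_trans Nn np); rewrite rnormB => h1 h2.
    have -> : partial m p f - partial m n f = (partial m p f - f) + (f - partial m n f).
      by rewrite addrA subrK.
    apply: (@le_trans _ _ (C * (e / 2 / (C + 1) + e / 2 / (C + 1)))).
      by rewrite ler_wpM2l//; apply: le_trans (rnormD _ _) _; exact: lerD.
    apply: (@le_trans _ _ ((C + 1) * (e / 2 / (C + 1) + e / 2 / (C + 1)))).
      by rewrite ler_wpM2r ?lerDl// addr_ge0// !divr_ge0// ltW.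
    rewrite le_eqVlt; apply/orP; left; apply/eqP; field.
    by rewrite gt_eqF.
  exists N => n p Nn Np; have [np|/ltnW pn] := leqP n p.
    by rewrite rnormB; exact: close.
  exact: close.
have [Z0 uZ] := choice ucvg.
have Z0E f x : hfs_fun (Z0 f) x = val x ord0 i * hfs_fun f x.
  have ev := @hfs_eval_continuous _ _ H x.
  have h1 : (fun N => hfs_fun (u f N) x : R[i]^o) @ \oo --> (hfs_fun (Z0 f) x : R[i]^o).
    exact: continuous_seq ev (uZ f).
  have h2 : (fun N => hfs_fun (partial m N f) x : R[i]^o) @ \oo -->
      (hfs_fun f x : R[i]^o).
    exact: continuous_seq ev (@partial_cvg _ _ _ _ _ wm f).
  apply: cvg_scalar_unique h1 _.
  have -> : (fun N => hfs_fun (u f N) x : R[i]^o) =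
      (fun N => val x ord0 i * hfs_fun (partial m N f) x : R[i]^o).
    by apply/funext => N; exact: uE.
  exact: cvgMr h2.
have Zmult : multiplier H (fun x => val x ord0 i) by move=> f; exists (Z0 f).
have [Z ZE] := multiplication_operator Zmult.
exists Z => //; apply/continuous_rnormP; exists C => f.
have -> : Z f = Z0 f by apply: (@hfs_fun_inj _ _ H); apply/funext => x; rewrite ZE Z0E.
apply/ler_addgt0Pr => e e0.
have C1 : 0 < 1 + C by rewrite ltr_wpDr.
have e1 : 0 < e / (1 + C) by rewrite divr_gt0.
have [N Nf] := (cvg_rnormP _ _).1 (@partial_cvg _ _ _ _ _ wm f) _ e1.
have [M Mf] := (cvg_rnormP _ _).1 (uZ f) _ e1.
pose n := maxn N M; have h1 := Nf n (leq_maxl _ _); have h2 := Mf n (leq_maxr _ _).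
have h3 : rnorm (u f n) <= C * rnorm (partial m n f).
  by have := ule f 0%N n (leq0n _); rewrite /u /partial !big_ord0 !subr0.
have h4 : rnorm (partial m n f) <= rnorm f + e / (1 + C).
  have -> : partial m n f = f - (f - partial m n f) by rewrite opprB addrC subrK.
  by apply: le_trans (rnormD _ _) _; rewrite rnormN lerD2l.
have -> : Z0 f = (Z0 f - u f n) + u f n by rewrite subrK.
apply: le_trans (rnormD _ _) _.
have -> : C * rnorm f + e = e / (1 + C) + C * (rnorm f + e / (1 + C)).
  by field; rewrite gt_eqF.
by apply: lerD => //; apply: le_trans h3 _; rewrite ler_wpM2l.
Qed.

End Coordinate.

(** * Joint eigenfunctionals of the coordinate multiplications *)

Lemma evaluation_functional (R : realType) (X : Type) (H : hilbert_function_space R X)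
    (x : X) :
  exists ev : {linear H -> R[i]^o}, continuous ev /\ forall f, ev f = hfs_fun f x.
Proof.
have [|ev evE] := @linear_mapP _ H R[i]^o (fun f => hfs_fun f x).
  by move=> k f g; rewrite linearP.
exists ev; split=> //; have -> : (ev : H -> R[i]^o) = fun f => hfs_fun f x.
  exact/funext.
exact: hfs_eval_continuous.
Qed.

Lemma continuous_scale_functional (R : realType) (V : normedModType R[i])
    (s : {linear V -> R[i]^o}) (c : R[i]^o) :
  continuous s -> continuous (c \*: s)%R.
Proof.
move=> /continuous_rnormP[C sC]; apply/(continuous_rnormP (c \*: s)%R).
by exists (rnorm c * C) => v /=; rewrite rnormZ -mulrA ler_wpM2l ?rnorm_ge0.
Qed.

Lemma eq_on_monomials (R : realType) d (X : set 'rV[R[i]]_d)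
    (H : hilbert_function_space R X) (m : multiindex d -> H)
    (s1 s2 : {linear H -> R[i]^o}) :
  weighted_monomials m -> continuous s1 -> continuous s2 ->
  (forall al, s1 (m al) = s2 (m al)) -> forall f, s1 f = s2 f.
Proof.
move=> wm /continuous_rnormP[C1 s1C] /continuous_rnormP[C2 s2C] s12 f.
apply: subr0_eq; apply: (monomials_total (s := (s1 \- s2)%R) wm) => [|al].
  apply/(continuous_rnormP (s1 \- s2)%R); exists (C1 + C2) => v /=.
  by apply: le_trans (rnormD _ _) _; rewrite rnormN mulrDl lerD.
by rewrite /= s12 subrr.
Qed.

Section Shells.
Context {R : realType} {d : nat} {X : set 'rV[R[i]]_d}.
Context {H : hilbert_function_space R X}.
Context {a : R^nat} {m : multiindex d -> H}.
Hypothesis ga : generating_function a.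
Hypothesis Xa : X = natural_domain a.
Hypothesis wm : weighted_monomials m.
Hypothesis rk : reproducing_kernel H
  (fun z w => genfun_value a (cdot (val z) (val w))).

Lemma cvg_realC (u : R^nat) (l : R) : u @ \oo --> l ->
  (fun n => (u n)%:C : R[i]^o) @ \oo --> (l%:C : R[i]^o).
Proof.
move=> /cvgrPdist_le ul; apply/cvg_rnormP => e e0.
have [N _ Nu] := ul e e0; exists N => n Nn.
by rewrite -rmorphB/= rnormC; exact: Nu.
Qed.

(** [genfun_value] is defined as a limit, which means something only where the
    series converges; a positive radius provides this near [0]. *)
Lemma genfun_cvg : exists2 s : R, 0 < s & forall t, 0 <= t -> t <= s ->
  (fun N => \sum_(k < N) (a k)%:C * t%:C ^+ k : R[i]^o) @ \oo -->
  (genfun_value a t%:C : R[i]^o).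
Proof.
have [_ _ /ereal_sup_gt[_ [r ar <-]]] := ga; rewrite lte_fin => r0.
exists (`|r| / 2) => [|t t0 tr]; first by rewrite divr_gt0.
have tlt : `|t| < `|r| by rewrite ger0_norm//; lra.
have /cvg_ex[l al] := is_cvg_pseries_inside ar tlt.
have alC := cvg_realC al.
have E : (fun N => \sum_(k < N) (a k)%:C * t%:C ^+ k : R[i]^o) =
    series (fun n => (a n)%:C * t%:C ^+ n : R[i]^o).
  by apply/funext => N; rewrite seriesEord.
have E2 : (fun n => (pseries a t n)%:C : R[i]^o) =
    (fun N => \sum_(k < N) (a k)%:C * t%:C ^+ k : R[i]^o).
  apply/funext => N; rewrite /pseries seriesEord rmorph_sum/=.
  by apply: eq_bigr => k _; rewrite rmorphM rmorphXn.
rewrite E2 in alC; rewrite /genfun_value -E.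
suff -> : limn (fun N => \sum_(k < N) (a k)%:C * t%:C ^+ k : R[i]^o) = l%:C by [].
exact/cvg_lim.
Qed.

(** The part of degree [n] of the kernel at [(v, v)], as computed from the
    orthonormal basis of normalized monomials. *)
Definition shell n (v : 'rV[R[i]]_d) : R :=
  \sum_(be : {ffun 'I_d -> 'I_n.+1} | mdeg (of_box be) == n)
    rnorm (monomial (of_box be) v : R[i]^o) ^+ 2 / rnorm (m (of_box be)) ^+ 2.

Lemma shell_scale n t v : shell n (t%:C *: v) = (t ^+ 2) ^+ n * shell n v.
Proof.
rewrite /shell mulr_sumr; apply: eq_bigr => be /eqP ben.
rewrite monomial_scale ben rnormM exprMn -[LHS]mulrA; congr (_ * _).
by rewrite -rmorphXn/= rnormC real_normK ?num_real// exprAC.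
Qed.

Lemma kernel_shell (x : X) (k : H) : (forall f : H, hfs_fun f x = hfs_dot f k) ->
  forall n, hfs_fun (homog m n k) x = (shell n (val x))%:C.
Proof.
move=> kx n; rewrite (fun_homog wm) /shell rmorph_sum/=; apply: eq_bigr => be _.
rewrite /coef (dotC k) -kx (monomialE wm) (dot_sqr (@hfs_norm_dot _ _ H)).
rewrite fmorph_div/= mulrAC; congr (_ / _).
by rewrite mulrC -normCK (rnormE (_ : R[i]^o)) rmorphXn.
Qed.

(** For small [t], the kernel at [(t * v, t * v)] expands in powers of
    [x = t ^ 2] in two ways: by the monomial basis and by the generating
    function.  Uniqueness of the coefficients gives the identity at [v] itself,
    even when [v] is outside the domain. *)
Lemma shellE n v : shell n v = a n * (cnorm v ^+ 2) ^+ n.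
Proof.
have [s [p [s0 pE]]] := ray_exists ga Xa v.
have [r r0 ar] := genfun_cvg.
pose A := cnorm v ^+ 2; have A0 : 0 <= A by exact: sqr_ge0.
pose b := Order.min (s ^+ 2) (r / (A + 1)).
have A1 : 0 < A + 1 by rewrite ltr_wpDl.
have b0 : 0 < b by rewrite lt_min exprn_gt0// divr_gt0.
apply: complexI.
apply: (@expands_unique _ b (fun n => (shell n v)%:C)
  (fun n => (a n * A ^+ n)%:C) (fun x => genfun_value a (x * A)%:C) b0).
  move=> x x0 xb.
  have q0 : 0 < Num.sqrt x by rewrite sqrtr_gt0.
  have qs : Num.sqrt x <= s.
    rewrite -(ger0_norm (ltW s0)) -sqrtr_sqr ler_sqrt ?sqr_ge0//.
    by apply: le_trans xb _; rewrite ge_min lexx.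
  have pq := pE _ q0 qs; have [k [kK kd]] := rk (p (Num.sqrt x)).
  have <- : hfs_fun k (p (Num.sqrt x)) = genfun_value a (x * A)%:C.
    have xA : cnorm (val (p (Num.sqrt x))) ^+ 2 = x * A.
      by rewrite pq cnorm_scale ?(ltW q0)// exprMn sqr_sqrtr ?(ltW x0).
    by rewrite kK cdot_cnorm xA.
  have -> : (fun N => \sum_(k < N) (shell k v)%:C * x%:C ^+ k : R[i]^o) =
      (fun N => hfs_fun (partial m N k) (p (Num.sqrt x)) : R[i]^o).
    apply/funext => N; rewrite (linear_sum (@hfs_fun R X H)) fct_sumE.
    apply: eq_bigr => j _; rewrite (kernel_shell kd) pq shell_scale.
    by rewrite sqr_sqrtr ?(ltW x0)// rmorphM rmorphXn mulrC.
  exact: continuous_seq (@hfs_eval_continuous _ _ H _) (@partial_cvg _ _ _ _ _ wm k).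
move=> x x0 xb.
have := ar (x * A) (mulr_ge0 (ltW x0) A0).
have xAr : x * A <= r.
  apply: (@le_trans _ _ (x * (A + 1))); first by rewrite ler_pM2l// lerDl.
  by rewrite -ler_pdivlMr//; apply: le_trans xb _; rewrite ge_min lexx orbT.
move=> /(_ xAr).
suff -> : (fun N => \sum_(k < N) (a k)%:C * (x * A)%:C ^+ k : R[i]^o) =
  (fun N => \sum_(k < N) (a k * A ^+ k)%:C * x%:C ^+ k : R[i]^o) by [].
apply/funext => N; apply: eq_bigr => k _.
by rewrite -!rmorphXn/= -!rmorphM/= exprMn; congr _%:C; ring.
Qed.


Lemma eigen_monomial (Z : 'I_d -> {linear H -> H}) (tau : {linear H -> R[i]^o})
    (w : 'rV[R[i]]_d) :
  (forall i f x, hfs_fun (Z i f) x = val x ord0 i * hfs_fun f x) ->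
  (forall i f, tau (Z i f) = w ord0 i * tau f) ->
  forall al, tau (m al) = monomial al w * tau (m [ffun=> 0%N]).
Proof.
move=> ZE tauZ al; have [n aln] : exists n, mdeg al = n by exists (mdeg al).
elim: n al aln => [|n IHn] al aln.
  have -> : al = [ffun=> 0%N].
    apply/ffunP => i; rewrite ffunE; apply/eqP; rewrite -leqn0 -aln; exact: leq_mdeg.
  by rewrite /monomial big1 ?mul1r// => i _; rewrite ffunE expr0.
have [i ai] : exists i, (0 < al i)%N.
  apply: contrapT => noi; have : mdeg al = 0%N; last by rewrite aln.
  rewrite /mdeg big1// => i _; apply/eqP; rewrite -leqn0 leqNgt.
  by apply/negP => ai; apply: noi; exists i.
pose be : multiindex d := [ffun j => (al j - (j == i))%N].
have aE : al = raise i be.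
  apply/ffunP => j; rewrite !ffunE subnK//.
  by case: eqP => // ->.
have mE : m al = Z i (m be).
  apply: (@hfs_fun_inj _ _ H); apply/funext => x.
  by rewrite ZE aE !(monomialE wm) monomial_raise.
rewrite mE tauZ IHn; first by rewrite aE monomial_raise mulrA.
by apply: succn_inj; rewrite -aln aE mdeg_raise.
Qed.

Lemma shell_bounded_mem (w : 'rV[R[i]]_d) (C : R) :
  (forall N, \sum_(n < N) shell n w <= C) -> natural_domain a w.
Proof.
move=> SC; apply: mem_natural_domain => //.
have [_ a0 _] := ga.
apply: nondecreasing_is_cvgn.
  apply: nondecreasing_series => n _ _ /=.
  by rewrite mulr_ge0 ?(ltW (a0 n))// exprn_ge0 ?sqr_ge0.
exists C => _ [N _ <-]; rewrite /pseries seriesEord; apply: le_trans (SC N).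
by rewrite le_eqVlt; apply/orP; left; apply/eqP; apply: eq_bigr => n _; rewrite shellE.
Qed.

(** Testing [tau] on the truncated kernel [F] at [w] gives [tau F = c * S] and
    [`|F| ^ 2 = S], where [S] is a partial sum of shells; boundedness of [tau]
    then bounds [S]. *)
Lemma functional_shell_bounded (tau : {linear H -> R[i]^o}) (w : 'rV[R[i]]_d)
    (c : R[i]^o) :
  continuous tau -> c != 0 -> (forall al, tau (m al) = monomial al w * c) ->
  natural_domain a w.
Proof.
move=> /(continuous_rnormP tau)[C tauC] c0 tauE.
have rc0 := rnorm_gt0 c0.
apply: (@shell_bounded_mem w ((`|C| / rnorm c) ^+ 2)) => N.
pose v be : R[i] := Num.conj (monomial be w) / hfs_dot (m be) (m be).
pose F := \sum_(0 <= n < N) \sum_(be : {ffun 'I_d -> 'I_n.+1} | mdeg (of_box be) == n)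
  v (of_box be) *: m (of_box be).
have normF : rnorm F ^+ 2 = \sum_(n < N) shell n w.
  rewrite /F (pythagoras_box wm v _ _ (@inj_id _)) big_mkord; apply: eq_bigr => n _.
  apply: eq_bigr => be _.
  rewrite /v (dot_sqr (@hfs_norm_dot _ _ H)) -fmorphV rnormMr ?invr_ge0 ?sqr_ge0//.
  have mb := rnorm_monomial_gt0 wm (of_box be).
  have -> : rnorm (Num.conj (monomial (of_box be) w) : R[i]^o) =
      rnorm (monomial (of_box be) w : R[i]^o) by rewrite /rnorm norm_conjC.
  by field; rewrite gt_eqF.
have tauF : tau F = (\sum_(n < N) shell n w)%:C * c.
  rewrite /F linear_sum/= big_mkord rmorph_sum/= mulr_suml; apply: eq_bigr => n _.
  rewrite linear_sum/= rmorph_sum/= mulr_suml; apply: eq_bigr => be _.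
  rewrite linearZ/= tauE /v (dot_sqr (@hfs_norm_dot _ _ H)) fmorph_div/=.
  rewrite -[LHS]/(_ * _) mulrA; congr (_ * _); rewrite mulrAC; congr (_ / _).
  by rewrite mulrC -normCK (rnormE (_ : R[i]^o)) rmorphXn.
have := tauC F; rewrite tauF -normF mulrC rnormMr ?sqr_ge0// => tF.
rewrite lerXn2r ?nnegrE ?divr_ge0 ?rnorm_ge0//.
have [->|F0] := eqVneq (rnorm F) 0; first by rewrite divr_ge0 ?rnorm_ge0.
have F1 : 0 < rnorm F by rewrite lt_def F0 rnorm_ge0.
rewrite ler_pdivlMr// -(ler_pM2r F1) -mulrA mulrCA -expr2.
by apply: le_trans tF _; rewrite ler_pM2r// ler_norm.
Qed.

(** The monomials are generated from [1] by the coordinate multiplications, so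
    the eigenvalues determine [tau] up to a constant. *)
Lemma eigenfunctional (Z : 'I_d -> {linear H -> H}) (tau : {linear H -> R[i]^o})
    (w : 'rV[R[i]]_d) :
  (forall i f x, hfs_fun (Z i f) x = val x ord0 i * hfs_fun f x) ->
  continuous tau -> (exists f, tau f != 0) ->
  (forall i f, tau (Z i f) = w ord0 i * tau f) ->
  exists x : X, val x = w /\ forall f, tau f = tau (m [ffun=> 0%N]) * hfs_fun f x.
Proof.
move=> ZE tauc [f0 tauf0] tauZ; have tauE := eigen_monomial ZE tauZ.
pose c := tau (m [ffun=> 0%N]).
have c0 : c != 0.
  apply: contraNneq tauf0 => c0; apply/eqP; apply: (monomials_total wm tauc) => al.
  by rewrite tauE -/c c0 mulr0.
have wX : w \in X by rewrite Xa; apply/mem_set/(functional_shell_bounded tauc c0 tauE).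
pose x : X := exist (fun z => z \in X) _ wX.
exists x; split=> // f; rewrite -/c.
have [ev [evc evE]] := evaluation_functional H x.
rewrite -evE; apply: (eq_on_monomials wm (s2 := (c \*: ev)%R) tauc) => [|al].
  exact: continuous_scale_functional.
by rewrite /= tauE evE (monomialE wm) mulrC.
Qed.

End Shells.

(** * Invertible weighted composition operators *)

Section OneSpace.
Context {R : realType} {d : nat} {X : set 'rV[R[i]]_d}.
Context {H : hilbert_function_space R X}.
Context {a : R^nat} {m : multiindex d -> H}.
Hypothesis ga : generating_function a.
Hypothesis Xa : X = natural_domain a.
Hypothesis wm : weighted_monomials m.

Lemma fun_one x : hfs_fun (m [ffun=> 0%N]) x = 1.
Proof. by rewrite (monomialE wm) /monomial big1// => i _; rewrite ffunE expr0. Qed.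

Lemma fun_coordinate i x : hfs_fun (m (axis i 1)) x = val x ord0 i.
Proof.
rewrite (monomialE wm) /monomial (bigD1 i)//= ffunE eqxx expr1 big1 ?mulr1//.
by move=> j /negbTE ji; rewrite ffunE ji expr0.
Qed.

(** The constant [1] forces [c = 1], and then the coordinates separate
    points. *)
Lemma points_separated (c : R[i]) (x y : X) :
  (forall f : H, hfs_fun f x = c * hfs_fun f y) -> x = y.
Proof.
move=> fxy; have c1 : c = 1.
  by have := fxy (m [ffun=> 0%N]); rewrite !fun_one mulr1.
apply/val_inj/rowP => i.
by have := fxy (m (axis i 1)); rewrite c1 mul1r !fun_coordinate.
Qed.

(** [rho f := f(0) + (d_i0 f)(0)] is never multiplicative, because it takes the
    values [1] and [0] at [z_i0] and [z_i0 ^ 2].  For a multiplier [p] without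
    first-order term, the Leibniz rule gives [rho (p * g) = rho p * rho g];
    hence, by consistency, some multiplier has a first-order term, and
    [multiplier_growth] applies to it. *)
Lemma consistent_growth i0 : algebraically_consistent H ->
  exists2 C, 0 <= C & forall n, rnorm (m (axis i0 n.+1)) <= C * rnorm (m (axis i0 n)).
Proof.
move=> cons.
have [[P PM P1]|noP] :=
    pselect (exists2 P : H, multiplier H (hfs_fun P) & coef m (axis i0 1) P != 0).
  exact: (multiplier_growth ga Xa wm PM P1).
pose rho : {linear H -> R[i]^o} := (coef m (axis i0 0) \+ coef m (axis i0 1))%R.
have rhoc : continuous rho.
  apply/(continuous_rnormP rho).
  exists ((rnorm (m (axis i0 0)))^-1 + (rnorm (m (axis i0 1)))^-1) => f.
  by apply: le_trans (rnormD _ _) _; rewrite mulrDl lerD ?rnorm_coef_le.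
have [|_ rhoM] := cons rho.
  split.
    split=> //; exists (m (axis i0 0)).
    by rewrite /= !coef_monomial// !axis_eq/= addr0 oner_neq0.
  move=> p g h pM pgh /=.
  rewrite (coef0_product ga Xa wm i0 pgh) (coef1_product ga Xa wm i0 pgh).
  have [->|p1] := eqVneq (coef m (axis i0 1) p) 0.
    by rewrite mul0r !addr0 mulrDr.
  by case: noP; exists p.
have : is_product (m (axis i0 1)) (m (axis i0 1)) (m (axis i0 2)).
  move=> x; rewrite !fun_coordinate (monomialE wm) /monomial (bigD1 i0)//=.
  rewrite ffunE eqxx expr2 big1 ?mulr1// => j /negbTE ji.
  by rewrite ffunE ji expr0.
move=> /rhoM/eqP; rewrite /= !coef_monomial// !axis_eq/= !add0r mulr1.
by rewrite eq_sym oner_eq0.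
Qed.

End OneSpace.

Section Composition.
Context {R : realType} {d1 d2 : nat}.
Context {X1 : set 'rV[R[i]]_d1} {X2 : set 'rV[R[i]]_d2}.
Context {H1 : hilbert_function_space R X1} {H2 : hilbert_function_space R X2}.
Context {l : X1 -> R[i]} {phi : X1 -> X2}.
Context {W : {linear H2 -> H1}} {V : {linear H1 -> H2}}.
Context {a1 a2 : R^nat} {m1 : multiindex d1 -> H1} {m2 : multiindex d2 -> H2}.
Hypothesis ga1 : generating_function a1.
Hypothesis Xa1 : X1 = natural_domain a1.
Hypothesis wm1 : weighted_monomials m1.
Hypothesis rk1 : reproducing_kernel H1
  (fun z w => genfun_value a1 (cdot (val z) (val w))).
Hypothesis wm2 : weighted_monomials m2.
Hypothesis rk2 : reproducing_kernel H2
  (fun z w => genfun_value a2 (cdot (val z) (val w))).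
Hypothesis Wc : continuous W.
Hypothesis WE : forall f x, hfs_fun (W f) x = l x * hfs_fun f (phi x).
Hypothesis WK : cancel W V.
Hypothesis VK : cancel V W.

Lemma weight_neq0 x : l x != 0.
Proof.
apply/eqP => lx0; have := WE (V (m1 [ffun=> 0%N])) x.
by rewrite VK (fun_one wm1) lx0 mul0r => /eqP; rewrite oner_eq0.
Qed.

(** The kernel functions of [H2] at the points [phi x] are total, because a
    function vanishing on the range of [phi] is killed by [W], and evaluation
    at [phi x] factors continuously through [W]. *)
Lemma inverse_composition_continuous : continuous V.
Proof.
apply: (inverse_continuous (@hfs_norm_dot _ _ H2) Wc VK WK) => f fperp.
apply: (can_inj WK); rewrite linear0; apply: (@hfs_fun_inj _ _ H1).
apply/funext => x; rewrite WE linear0.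
suff -> : hfs_fun f (phi x) = 0 by rewrite mulr0.
have [k [_ kE]] := rk2 (phi x); rewrite kE.
have [ev [evc evE]] := evaluation_functional H1 x.
apply: (fperp k ((l x)^-1 \*: ev)%R) => [|h].
  exact: continuous_scale_functional.
by rewrite -kE /= evE WE [RHS]mulKf// weight_neq0.
Qed.

Context {Z2 : 'I_d2 -> {linear H2 -> H2}}.
Hypothesis Z2E : forall j f y, hfs_fun (Z2 j f) y = val y ord0 j * hfs_fun f y.

Lemma symbol_multiplication j g x :
  hfs_fun (W (Z2 j (V g))) x = val (phi x) ord0 j * hfs_fun g x.
Proof. by rewrite WE Z2E mulrCA -WE VK. Qed.

(** The coordinate [j] of [phi], as an element of [H1]. *)
Definition symbol_coordinate j : H1 := W (Z2 j (V (m1 [ffun=> 0%N]))).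

Lemma symbol_coordinateE j x : hfs_fun (symbol_coordinate j) x = val (phi x) ord0 j.
Proof. by rewrite symbol_multiplication (fun_one wm1) mulr1. Qed.

Lemma symbol_coordinate_multiplier j : multiplier H1 (hfs_fun (symbol_coordinate j)).
Proof.
move=> g; exists (W (Z2 j (V g))) => x.
by rewrite symbol_multiplication symbol_coordinateE.
Qed.

Lemma symbol_coordinate_product j f :
  is_product (symbol_coordinate j) (W f) (W (Z2 j f)).
Proof.
by move=> x; rewrite -[in LHS](WK f) symbol_multiplication symbol_coordinateE.
Qed.

(** If all first-order coefficients of [phi] vanish, then by the Leibniz rule
    the functionals [tau 0] and [tau 1], value and derivative at [0] composed
    with [W], are multiplied by the same number [w j] when [f] is replaced by
    [z_j * f].  So they are proportional, and since [W] is onto, value and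
    derivative at [0] are proportional on [H1].  Testing on [1] and [z_i0] kills
    both constants. *)
Lemma symbol_derivative_neq0 i0 :
  exists j, coef m1 (axis i0 1) (symbol_coordinate j) != 0.
Proof.
apply: contrapT => noj.
have P1 j : coef m1 (axis i0 1) (symbol_coordinate j) = 0.
  by apply/eqP/negP => /negP Pj; apply: noj; exists j.
pose w := \row_j (coef m1 (axis i0 0) (symbol_coordinate j) : R[i]).
pose tau n : {linear H2 -> R[i]^o} := (coef m1 (axis i0 n) \o W)%R.
have tauc n : continuous (tau n).
  move=> f; apply: continuous_comp; first exact: Wc.
  exact: coef_continuous.
have tau0Z j f : tau 0%N (Z2 j f) = w ord0 j * tau 0%N f.
  by rewrite /= mxE (coef0_product ga1 Xa1 wm1 i0 (symbol_coordinate_product j f)).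
have tau1Z j f : tau 1%N (Z2 j f) = w ord0 j * tau 1%N f.
  rewrite /= mxE (coef1_product ga1 Xa1 wm1 i0 (symbol_coordinate_product j f)).
  by rewrite P1 mul0r addr0.
have tau0E := eigen_monomial wm2 Z2E tau0Z.
have tau1E := eigen_monomial wm2 Z2E tau1Z.
pose c0 := tau 0%N (m2 [ffun=> 0%N]); pose c1 := tau 1%N (m2 [ffun=> 0%N]).
have proportional g : c1 * coef m1 (axis i0 0) g = c0 * coef m1 (axis i0 1) g.
  rewrite -(VK g); apply: (eq_on_monomials (s1 := (c1 \*: tau 0%N)%R)
    (s2 := (c0 \*: tau 1%N)%R) wm2) => [||al].
  - exact: continuous_scale_functional.
  - exact: continuous_scale_functional.
  rewrite -[LHS]/(c1 * tau 0%N (m2 al)) -[RHS]/(c0 * tau 1%N (m2 al)).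
  by rewrite tau0E tau1E -/c0 -/c1 mulrCA [RHS]mulrCA [c1 * c0]mulrC.
have c10 : c1 = 0.
  have := proportional (m1 (axis i0 0)).
  by rewrite !coef_monomial// !axis_eq/= mulr1 mulr0.
have c00 : c0 = 0.
  have := proportional (m1 (axis i0 1)).
  by rewrite !coef_monomial// !axis_eq/= mulr1 mulr0.
have tau00 f : tau 0%N f = 0.
  by apply: (monomials_total wm2 (tauc 0%N)) => al; rewrite tau0E -/c0 c00 mulr0.
have := tau00 (V (m1 (axis i0 0))); rewrite /= VK coef_monomial// axis_eq/=.
by move/eqP; rewrite oner_eq0.
Qed.

Context {Z1 : 'I_d1 -> {linear H1 -> H1}}.
Hypothesis Z1c : forall i, continuous (Z1 i).
Hypothesis Z1E : forall i g x, hfs_fun (Z1 i g) x = val x ord0 i * hfs_fun g x.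

(** [rho g := (V g)(y)] satisfies [rho (phi_j * g) = y_j * rho g].  Multiplying
    by [z_i] on [H1] commutes with multiplying by [phi_j], so
    [sigma i f := rho (z_i * W f)] has the same eigenvalues [y_j] under the
    coordinate multiplications of [H2] and must be a multiple [w_i] of the
    evaluation at [y].  Hence [rho (z_i * g) = w_i * rho g] on [H1]. *)
Lemma evaluation_pullback (y : X2) : exists x : X1, forall g,
  hfs_fun (V g) y = hfs_fun (V (m1 [ffun=> 0%N])) y * hfs_fun g x.
Proof.
have [ev [evc evE]] := evaluation_functional H2 y.
pose rho : {linear H1 -> R[i]^o} := (ev \o V)%R.
have Vc := inverse_composition_continuous.
have rhoc : continuous rho by move=> g; apply: continuous_comp; [exact: Vc|exact: evc].
have rhoW f : rho (W f) = hfs_fun f y by rewrite /= WK evE.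
pose sigma i : {linear H2 -> R[i]^o} := ((rho \o Z1 i)%R \o W)%R.
have sigmac i : continuous (sigma i).
  move=> f; apply: continuous_comp; first exact: Wc.
  by apply: continuous_comp; [exact: Z1c|exact: rhoc].
have Z1Z2 i j f : Z1 i (W (Z2 j f)) = W (Z2 j (V (Z1 i (W f)))).
  apply: (@hfs_fun_inj _ _ H1); apply/funext => x.
  rewrite symbol_multiplication !Z1E symbol_coordinate_product.
  by rewrite symbol_coordinateE mulrCA.
have sigmaZ i j f : sigma i (Z2 j f) = val y ord0 j * sigma i f.
  by rewrite -[LHS]/(rho (Z1 i (W (Z2 j f)))) Z1Z2 rhoW Z2E -rhoW VK.
have sigmaE i f : sigma i f = sigma i (m2 [ffun=> 0%N]) * hfs_fun f y.
  have se := eigen_monomial wm2 Z2E (sigmaZ i).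
  set c := sigma i (m2 [ffun=> 0%N]) in se *.
  have sc al : sigma i (m2 al) = (c \*: ev)%R (m2 al).
    by rewrite se -[RHS]/(c * ev (m2 al)) evE (monomialE wm2) mulrC.
  have cevc := continuous_scale_functional (c := c) evc.
  have -> := eq_on_monomials wm2 (sigmac i) cevc sc f.
  by rewrite -[LHS]/(c * ev f) evE.
pose w := \row_i (sigma i (m2 [ffun=> 0%N]) : R[i]).
have rhoZ i g : rho (Z1 i g) = w ord0 i * rho g.
  by rewrite mxE -[g]VK rhoW -sigmaE.
have rho0 : exists g, rho g != 0.
  by exists (W (m2 [ffun=> 0%N])); rewrite rhoW (fun_one wm2) oner_neq0.
have [x [_ xE]] := eigenfunctional ga1 Xa1 wm1 rk1 Z1E rhoc rho0 rhoZ.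
by exists x => g; rewrite -!evE; exact: xE.
Qed.

End Composition.

Theorem proposition6p5 (R : realType) (d1 d2 : nat)
    (X1 : set 'rV[R[i]]_d1) (X2 : set 'rV[R[i]]_d2)
    (H1 : hilbert_function_space R X1) (H2 : hilbert_function_space R X2)
    (l : X1 -> R[i]) (phi : X1 -> X2) (W : {linear H2 -> H1}) :
  (0 < d1)%N -> (0 < d2)%N ->
  weighted_hardy_space H1 -> weighted_hardy_space H2 ->
  algebraically_consistent H2 ->
  weighted_composition l phi W -> bijective W ->
  bijective phi /\
  exists (V : {linear H1 -> H2}) (mu : X2 -> R[i]) (psi : X2 -> X1),
    [/\ cancel W V, cancel V W & weighted_composition mu psi V].
Proof.
move=> d10 d20 [[m1 wm1] [a1 [ga1 rk1 Xa1 _]]] [[m2 wm2] [a2 [ga2 rk2 Xa2 _]]].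
move=> cons [Wc WE] [V0 WV0 V0W].
have [|V VE] := @linear_mapP _ H1 H2 V0.
  by move=> c f g; apply: (can_inj WV0); rewrite linearP !V0W.
have WK : cancel W V by move=> f; rewrite VE WV0.
have VK : cancel V W by move=> g; rewrite VE V0W.
have [C2 C20 growth2] := consistent_growth ga2 Xa2 wm2 (Ordinal d20) cons.
have /choice[Z2 Z2P] j : exists Z : {linear H2 -> H2}, continuous Z /\
    forall f y, hfs_fun (Z f) y = val y ord0 j * hfs_fun f y.
  by have [Z Zc ZE] := coordinate_multiplication wm2 C20 growth2 j; exists Z.
have Z2E j := (Z2P j).2.
have [j Pj] := symbol_derivative_neq0 ga1 Xa1 wm1 wm2 Wc WE WK VK Z2E (Ordinal d10).
have Pmult := symbol_coordinate_multiplier wm1 WE VK Z2E j.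
have [C1 C10 growth1] := multiplier_growth ga1 Xa1 wm1 Pmult Pj.
have /choice[Z1 Z1P] i : exists Z : {linear H1 -> H1}, continuous Z /\
    forall g x, hfs_fun (Z g) x = val x ord0 i * hfs_fun g x.
  by have [Z Zc ZE] := coordinate_multiplication wm1 C10 growth1 i; exists Z.
have [psi psiE] := choice (evaluation_pullback ga1 Xa1 wm1 rk1 wm2 rk2 Wc WE WK VK Z2E
  (fun i => (Z1P i).1) (fun i => (Z1P i).2)).
pose mu y := hfs_fun (V (m1 [ffun=> 0%N])) y.
have phiK : cancel phi psi.
  move=> x; apply/esym/(@points_separated _ _ _ _ _ wm1 (l x * mu (phi x))) => g.
  by rewrite -[in LHS](VK g) WE psiE mulrA.
have psiK : cancel psi phi.
  move=> y; apply/esym/(@points_separated _ _ _ _ _ wm2 (mu y * l (psi y))) => f.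
  by rewrite -[in LHS](WK f) psiE WE mulrA.
split; first by exists psi.
exists V, mu, psi; split=> //; split=> [|g y]; last exact: psiE.
exact: (inverse_composition_continuous wm1 rk2 Wc WE WK VK).
Qed.
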